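(* Let $\mathcal{T}\subseteq[0,\infty)$ be a convex set with non-empty interior, and let $Z=(t_1,t_2)$ be observed on $\mathcal{T}^2$ with Lebesgue density given, up to a normalizing constant, by $$f_{\eta_0}(t_1,t_2)=\int_{\mathbb{R}\times[0,\infty)}\frac{\alpha_2^2}{t_1^{3/2}t_2^{3/2}}\exp\Big(-\frac{(\alpha_1t_1-\alpha_2)^2}{2t_1}-\frac{(\alpha_1t_2-\alpha_2)^2}{2t_2}\Big)d\eta_0(\alpha_1,\alpha_2).$$ Assume UH $\alpha=(\alpha_1,\alpha_2)$ is nonparametric, and let $r\in L_2(\eta_0)$ be locally bounded. If $\phi(\eta_0)=\mathbb{E}_{\eta_0}[r(\alpha_1,\alpha_2)]$ is regularly identified, then there exist constants $C_1,C_2$ and a continuous function $h(u,v)$ on $(0,\infty)^2$ such that $$r(\alpha_1,\alpha_2)=C_1+C_2\,\alpha_2^2\,e^{2\alpha_1\alpha_2}\,h(\alpha_1^2,\alpha_2^2)$$ ($\eta_0$-a.s., where $\alpha_1\neq0$, $\alpha_2>0$); moreover, if $\mathcal{T}$ is bounded, $h(u,v)$ is infinitely many times differentiable in $u$ at every $u\in(0,\infty)$, for all $v\in(0,\infty)$.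
   Context: Setting: $\alpha=(\alpha_1,\alpha_2)\in\mathbb{R}\times[0,\infty)$ is unobserved heterogeneity (UH) with unknown distribution $\eta_0\in H$, a class of distributions. Write $f_{z/\alpha}(t_1,t_2)=C\,\alpha_2^2t_1^{-3/2}t_2^{-3/2}\exp(-(\alpha_1t_1-\alpha_2)^2/(2t_1)-(\alpha_1t_2-\alpha_2)^2/(2t_2))$ with $C>0$ the normalizing constant (not depending on $t_1,t_2,\alpha$), so the normalized density of $Z$ on $\mathcal{T}^2$ is $f_{\eta_0}=\int f_{z/\alpha}\,d\eta_0(\alpha)$; $\mathbb{P}$ is the law of $Z$. $L_2^0(\nu)$ denotes zero-$\nu$-mean functions in $L_2(\nu)$; equalities in $L_2(\eta_0)$ are $\eta_0$-a.s. Tangent space: a path $\eta_t\in H$, $t\in[0,\varepsilon)$, has score $b\in L_2(\eta_0)$ if $\int[(d\eta_t^{1/2}-d\eta_0^{1/2})/t-\tfrac12 b\,d\eta_0^{1/2}]^2\to0$ as $t\downarrow0$. $T(\eta_0)$ is the linear span of all such $b$. UH is nonparametric if $T(\eta_0)$ is dense in $L_2^0(\eta_0)$. Regular identification: the score operator is $Ab(z)=\int b(\alpha)f_{z/\alpha}(z)d\eta_0(\alpha)/f_{\eta_0}(z)$, centered to have zero $\mathbb{P}$-mean. For $\phi(\eta)=\mathbb{E}_\eta[r(\alpha)]$ with gradient $r_\phi=r-\phi(\eta_0)$, the efficiency bound is $\sup_{b\in T(\eta_0)}(\mathbb{E}_{\eta_0}[r_\phi b])^2/\mathbb{E}[(Ab(Z))^2]$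 (with $0/0=0$, $c/0=\infty$ for $c>0$). $\phi(\eta_0)$ is regularly identified if it is identified (determined by the law of $Z$ within the model) with a finite efficiency bound. *)

(* Defs.v *)
From HB Require Import structures.
From mathcomp Require Import all_boot all_order all_algebra.
From mathcomp Require Import all_classical all_reals all_analysis.
Set Implicit Arguments.
Unset Strict Implicit.
Unset Printing Implicit Defensive.
Import Order.TTheory GRing.Theory Num.Theory.
Import numFieldNormedType.Exports.
Local Open Scope classical_set_scope.
Local Open Scope ring_scope.
Local Open Scope charge_scope.

(* The Borel structure on R carried by [lebesgue_measure]. *)
Notation plane R := (measurableTypeR R * measurableTypeR R)%type.

Section UnobservedHeterogeneity.
Context {R : realType}.

(* A distribution on R x [0, +oo[ is represented by a probability measure on
   the whole plane that gives mass 1 to this set. *)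
Definition UH_space : set (R * R) := [set a | 0 <= a.2].

Definition distributions_on_UH (H : set (probability (plane R) R)) :=
  forall eta, H eta -> eta UH_space = 1%E.

(* [sqrt_density eta mu] is d eta^{1/2} / d mu^{1/2} when mu dominates eta. *)
Definition sqrt_density (eta : probability (plane R) R)
    (mu : {sigma_finite_measure set (plane R) -> \bar R}) (a : R * R) : R :=
  Num.sqrt (fine (('d (charge_of_finite_measure eta) '/d mu) a)).

(* The integral of ((d eta_t^{1/2} - d eta_0^{1/2}) / t - b d eta_0^{1/2} / 2)^2
   is computed with respect to a measure mu t dominating eta_t and eta_0; its
   value does not depend on the choice of mu t. *)
Definition is_score (H : set (probability (plane R) R))
    (eta0 : probability (plane R) R) (b : R * R -> R) :=
  b \in Lfun eta0 2%:E /\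
  exists (eta : R -> probability (plane R) R) (eps : R)
         (mu : R -> {sigma_finite_measure set (plane R) -> \bar R}),
    [/\ 0 < eps,
        forall t, 0 <= t < eps -> H (eta t),
        eta 0 = eta0,
        forall t, 0 < t < eps -> eta t `<< mu t /\ eta0 `<< mu t &
        (\int[mu t]_a (((sqrt_density (eta t) (mu t) a
                         - sqrt_density eta0 (mu t) a) / t
                        - 2^-1 * b a * sqrt_density eta0 (mu t) a) ^+ 2)%:E)%E
          @[t --> 0^'+] --> (0 : \bar R)%E].

Definition tangent_space (H : set (probability (plane R) R))
    (eta0 : probability (plane R) R) : set (R * R -> R) :=
  [set b | exists (n : nat) (c : 'I_n -> R) (s : 'I_n -> R * R -> R),
     (forall i, is_score H eta0 (s i)) /\
     b = (fun a => \sum_(i < n) c i * s i a)].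

Definition L20 (nu : probability (plane R) R) : set (R * R -> R) :=
  [set g | g \in Lfun nu 2%:E /\ \int[nu]_a g a = 0].

Definition nonparametric (H : set (probability (plane R) R))
    (eta0 : probability (plane R) R) :=
  forall g, L20 eta0 g -> forall e : R, 0 < e ->
    exists2 b, tangent_space H eta0 b &
      ('N[eta0]_2%:E[EFin \o (g \- b)%R] < e%:E)%E.

End UnobservedHeterogeneity.

Section DurationModel.
Context {R : realType}.

Definition lebesgue2 : {measure set (plane R) -> \bar R} :=
  (@lebesgue_measure R \x @lebesgue_measure R)%E.

Definition duration_kernel (a z : R * R) : R :=
  a.2 ^+ 2 * z.1 `^ (- (3 / 2)) * z.2 `^ (- (3 / 2)) *
  expR (- ((a.1 * z.1 - a.2) ^+ 2 / (2 * z.1))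
        - ((a.1 * z.2 - a.2) ^+ 2 / (2 * z.2))).

Variable T : set R.

(* The integral of the kernel over T^2 depends on alpha, so the constant that
   turns the mixture into a probability density depends on eta. *)
Definition norm_const (eta : probability (plane R) R) : R :=
  (\int[lebesgue2]_(z in T `*` T) \int[eta]_a duration_kernel a z)^-1.

Definition cond_density (eta0 : probability (plane R) R) (a z : R * R) : R :=
  norm_const eta0 * duration_kernel a z.

Definition density_Z (eta : probability (plane R) R) (z : R * R) : R :=
  \int[eta]_a cond_density eta a z.

Definition law_Z (eta : probability (plane R) R) (A : set (plane R)) : \bar R :=
  (\int[lebesgue2]_(z in A `&` (T `*` T)) (density_Z eta z)%:E)%E.

Definition is_law_Z (eta P : probability (plane R) R) :=
  forall A, measurable A -> P A = law_Z eta A.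

Definition score_operator (eta0 P : probability (plane R) R)
    (b : R * R -> R) (z : R * R) : R :=
  let S z := (\int[eta0]_a (b a * cond_density eta0 a z)) / density_Z eta0 z in
  S z - \int[P]_z' S z'.

Definition phi (r : R * R -> R) (eta : probability (plane R) R) : R :=
  \int[eta]_a r a.

(* Division in \bar R follows the intended conventions: 0 / 0 = 0 and
   c / 0 = +oo for c > 0. *)
Definition efficiency_bound (H : set (probability (plane R) R))
    (eta0 P : probability (plane R) R) (r : R * R -> R) : \bar R :=
  ereal_sup [set x | exists2 b, tangent_space H eta0 b &
    x = (((\int[eta0]_a ((r a - phi r eta0) * b a)) ^+ 2)%:E
         / \int[P]_z ((score_operator eta0 P b z) ^+ 2)%:E)%E].

(* phi(eta) only makes sense for the eta in H that integrate r. *)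
Definition identified (H : set (probability (plane R) R))
    (eta0 : probability (plane R) R) (r : R * R -> R) :=
  forall eta, H eta -> eta.-integrable setT (EFin \o r) ->
    (forall A, measurable A -> law_Z eta A = law_Z eta0 A) ->
    phi r eta = phi r eta0.

Definition regularly_identified (H : set (probability (plane R) R))
    (eta0 P : probability (plane R) R) (r : R * R -> R) :=
  identified H eta0 r /\ (efficiency_bound H eta0 P r < +oo)%E.

End DurationModel.

(* Main.v *)
(* Write A b for the score operator and q(a, z) for the truncated kernel
   N * f_(z/a) * 1_(T x T).  A finite efficiency bound says that
   b |-> E[r_phi b] is bounded by a multiple of ||A b|| on the tangent space, so
   by the Riesz representation it is b |-> <g, A b> for some g in L_2(P); as the
   tangent space is dense in L_2^0, r differs from a |-> int g(z) q(a, z) dz by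
   a constant.  For a2 > 0 the kernel is a2^2 e^(2 a1 a2) times the Laplace kernel
   exp(- u (t1 + t2) / 2 - v (1/t1 + 1/t2) / 2) at (u, v) = (a1^2, a2^2), so the
   natural choice for h is the Laplace transform of g.

   This transform need not converge on all of (0, oo)^2.  But g is square
   integrable: for eta0-almost every a, the integral of g^2 against the Laplace
   kernel converges at (a1^2, a2^2), and by AM-GM the transform of g itself then
   converges beyond half that point.  So the transform is continuous on a
   neighborhood of the closure of the set of points that matter, and a retraction
   onto this closure extends it to (0, oo)^2. *)

Require Import Defs.
From HB Require Import structures.
From mathcomp Require Import all_boot all_order all_algebra.
From mathcomp Require Import all_classical all_reals all_analysis.
From mathcomp Require Import measurable_realfun lebesgue_integral_under.
From mathcomp Require Import ring lra.
Import Order.TTheory GRing.Theory Num.Theory.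
Import numFieldNormedType.Exports.
Local Open Scope classical_set_scope.
Local Open Scope ring_scope.
Set Implicit Arguments.
Unset Strict Implicit.
Unset Printing Implicit Defensive.

(** * Square integrable functions *)

(** The factor [norm_const] depends on the mixing distribution and not on a, so q(a, .) need not be
    a probability density for fixed a. A bound on its integral that is uniform in a takes over this
    role: given a, the kernel is a product of two passage densities, and each of them has integral
    at most 4 pi whatever a is. This bound, [M] below, makes A bounded from L_2(eta0) to L_2(P) and
    its adjoint bounded in the other direction. A b is linear in b only up to P-null sets. Functions
    are not replaced by their classes here; instead the functional A b |-> E[r_phi b] is handed to
    the Riesz theorem as a graph. The retraction at the end exists because the Laplace kernel
    decreases in u and in v: the set where g^2 is integrable against it is closed under increasing
    either coordinate, so the time needed to reach it along a fixed direction is a Lipschitz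
    function of the starting point. *)

Section RealIntegrable.
Context {d} {X : measurableType d} {R : realType}.
Variable mu : {measure set X -> \bar R}.
Implicit Types (f g k : X -> R).

Definition rintegrable (f : X -> R) := mu.-integrable setT (EFin \o f).

Lemma rintegrable_measurable f : rintegrable f -> measurable_fun setT f.
Proof. by move=> /integrableP[/measurable_EFinP]. Qed.

Lemma rintegrableD f g :
  rintegrable f -> rintegrable g -> rintegrable (fun x => f x + g x).
Proof. by move=> hf hg; have := integrableD measurableT hf hg. Qed.

Lemma rintegrableZ c f : rintegrable f -> rintegrable (fun x => c * f x).
Proof. by move=> hf; have := integrableZl measurableT c hf. Qed.

Lemma rintegrableB f g :
  rintegrable f -> rintegrable g -> rintegrable (fun x => f x - g x).
Proof. by move=> hf hg; have := integrableB measurableT hf hg. Qed.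

Lemma le_rintegrable f g : measurable_fun setT f ->
  (forall x, `|f x| <= g x) -> rintegrable g -> rintegrable f.
Proof.
move=> mf fg; apply: le_integrable => //; first exact/measurable_EFinP.
by move=> x _ /=; rewrite lee_fin (le_trans (fg x))// ler_norm.
Qed.

Lemma rintegrable_lty f : measurable_fun setT f -> (forall x, 0 <= f x) ->
  (\int[mu]_x (f x)%:E < +oo)%E -> rintegrable f.
Proof.
move=> mf f0 foo; apply/integrableP; split; first exact/measurable_EFinP.
by under eq_integral do rewrite /= ger0_norm//.
Qed.

Lemma EFin_Rintegral f : rintegrable f ->
  (\int[mu]_x f x)%:E = (\int[mu]_x (f x)%:E)%E.
Proof. by move=> hf; rewrite /Rintegral fineK//; exact: integrable_fin_num. Qed.

Lemma ae_eq_Rintegral f g : measurable_fun setT f -> measurable_fun setT g ->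
  {ae mu, forall x, f x = g x} -> \int[mu]_x f x = \int[mu]_x g x.
Proof.
move=> mf mg fg; congr fine; apply: ae_eq_integral => //.
- exact/measurable_EFinP.
- exact/measurable_EFinP.
- by apply: filterS fg => x /= ->.
Qed.

Lemma ae_imply (A B : X -> Prop) : (forall x, A x -> B x) ->
  {ae mu, forall x, A x} -> {ae mu, forall x, B x}.
Proof. by move=> AB; apply: filterS. Qed.

Definition square_integrable (f : X -> R) :=
  measurable_fun setT f /\ rintegrable (fun x => f x ^+ 2).

Lemma square_integrable_lty f : measurable_fun setT f ->
  (\int[mu]_x (f x ^+ 2)%:E < +oo)%E -> square_integrable f.
Proof.
move=> mf foo; split=> //; apply: rintegrable_lty => //.
  exact: measurable_funX.
by move=> x; rewrite sqr_ge0.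
Qed.

Lemma square_integrableM f g : square_integrable f -> square_integrable g ->
  rintegrable (fun x => f x * g x).
Proof.
move=> [mf hf] [mg hg]; apply: le_rintegrable (rintegrableD hf hg).
  exact: measurable_funM.
move=> x; rewrite ler_norml; apply/andP; split; nra.
Qed.

Lemma square_integrableD f g : square_integrable f -> square_integrable g ->
  square_integrable (fun x => f x + g x).
Proof.
move=> [mf hf] [mg hg]; have mfg := measurable_funD mf mg; split => //.
apply: le_rintegrable (rintegrableZ 2 (rintegrableD hf hg)).
  exact: measurable_funX.
move=> x; rewrite ger0_norm ?sqr_ge0//.
have := sqr_ge0 (f x - g x); rewrite !expr2; nra.
Qed.

Lemma square_integrableZ c f : square_integrable f ->
  square_integrable (fun x => c * f x).
Proof.
move=> [mf hf]; split; first exact: measurable_funM.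
have := rintegrableZ (c ^+ 2) hf.
by under [in X in X -> _]eq_fun do rewrite -exprMn.
Qed.

Lemma square_integrableB f g : square_integrable f -> square_integrable g ->
  square_integrable (fun x => f x - g x).
Proof.
move=> hf hg; have := square_integrableD hf (square_integrableZ (-1) hg).
by under eq_fun do rewrite mulN1r.
Qed.

Lemma square_integrable_ae_eq f g : square_integrable f ->
  measurable_fun setT g -> {ae mu, forall x, f x = g x} -> square_integrable g.
Proof.
move=> [mf hf] mg fg; apply: square_integrable_lty => //.
rewrite (ae_eq_integral (fun x => (f x ^+ 2)%:E)) => [|//|||].
- by rewrite -EFin_Rintegral// ltry.
- by apply/measurable_EFinP; exact: measurable_funX.
- by apply/measurable_EFinP; exact: measurable_funX.
- by apply: filterS fg => x /= ->.
Qed.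

Definition inner (f g : X -> R) : R := \int[mu]_x (f x * g x).

Lemma innerC f g : inner f g = inner g f.
Proof. by apply: eq_Rintegral => x _; rewrite mulrC. Qed.

Lemma innerDl f g k : square_integrable f -> square_integrable g ->
  square_integrable k -> inner (fun x => f x + g x) k = inner f k + inner g k.
Proof.
move=> hf hg hk; rewrite -RintegralD//; try exact: square_integrableM.
by apply: eq_Rintegral => x _; rewrite mulrDl.
Qed.

Lemma innerZl c f k : square_integrable f -> square_integrable k ->
  inner (fun x => c * f x) k = c * inner f k.
Proof.
move=> hf hk; rewrite -RintegralZl//; last exact: square_integrableM.
by apply: eq_Rintegral => x _; rewrite mulrA.
Qed.

Lemma innerBl f g k : square_integrable f -> square_integrable g ->
  square_integrable k -> inner (fun x => f x - g x) k = inner f k - inner g k.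
Proof.
move=> hf hg hk; rewrite -RintegralB//; try exact: square_integrableM.
by apply: eq_Rintegral => x _; rewrite mulrBl.
Qed.

Lemma innerDr f g k : square_integrable f -> square_integrable g ->
  square_integrable k -> inner k (fun x => f x + g x) = inner k f + inner k g.
Proof. by move=> *; rewrite innerC innerDl// !(innerC k). Qed.

Lemma innerBr f g k : square_integrable f -> square_integrable g ->
  square_integrable k -> inner k (fun x => f x - g x) = inner k f - inner k g.
Proof. by move=> *; rewrite innerC innerBl// !(innerC k). Qed.

Lemma innerZr c f k : square_integrable f -> square_integrable k ->
  inner k (fun x => c * f x) = c * inner k f.
Proof. by move=> *; rewrite innerC innerZl// innerC. Qed.

Lemma inner_ge0 f : 0 <= inner f f.
Proof. by apply: Rintegral_ge0 => x _; rewrite -expr2 sqr_ge0. Qed.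

Lemma inner_sqr_combination c f g : square_integrable f -> square_integrable g ->
  inner (fun x => f x + c * g x) (fun x => f x + c * g x) =
  inner f f + 2 * c * inner f g + c ^+ 2 * inner g g.
Proof.
move=> hf hg; have hcg := square_integrableZ c hg.
have hfcg := square_integrableD hf hcg.
rewrite innerDl// !innerDr// !innerZl// !innerZr// (innerC g f); ring.
Qed.

Lemma discriminant_le (a b c : R) : 0 <= c ->
  (forall t, 0 <= a + 2 * t * b + t ^+ 2 * c) -> b ^+ 2 <= a * c.
Proof.
rewrite le_eqVlt => /predU1P[<-|c0] h.
  have [->|b0] := eqVneq b 0; first by rewrite expr0n mulr0.
  (* With c = 0 the polynomial is affine, and this is the point where it takes the value -1. *)
  have := h (- (a + 1) / (2 * b)); rewrite mulr0 addr0.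
  have -> : a + 2 * (- (a + 1) / (2 * b)) * b = -1 by field.
  by rewrite oppr_ge0 ler10.
have := h (- b / c).
have -> : a + 2 * (- b / c) * b + (- b / c) ^+ 2 * c = (a * c - b ^+ 2) / c.
  by field; rewrite gt_eqF.
by rewrite pmulr_lge0 ?invr_gt0// subr_ge0.
Qed.

Lemma Cauchy_Schwarz f g : square_integrable f -> square_integrable g ->
  inner f g ^+ 2 <= inner f f * inner g g.
Proof.
move=> hf hg; apply: discriminant_le; first exact: inner_ge0.
by move=> t; rewrite -inner_sqr_combination// inner_ge0.
Qed.

Lemma inner_eq0 f : square_integrable f -> inner f f = 0 ->
  {ae mu, forall x, f x = 0}.
Proof.
move=> [mf hf] ff0.
have mf2 : measurable_fun setT (fun x => (f x ^+ 2)%:E).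
  by apply/measurable_EFinP; exact: measurable_funX.
have : (\int[mu]_x `|(f x ^+ 2)%:E| = 0)%E.
  under eq_integral do rewrite abse_EFin ger0_norm ?sqr_ge0//.
  rewrite -(EFin_Rintegral hf); congr EFin; rewrite -[RHS]ff0.
  by apply: eq_Rintegral => x _; rewrite -expr2.
move/(ae_eq_integral_abs mu measurableT mf2); apply: filterS => x /= /(_ I) [].
by move/eqP; rewrite sqrf_eq0 => /eqP.
Qed.

End RealIntegrable.

Section SquareIntegrableComplete.
Context {d} {X : measurableType d} {R : realType}.
Variable mu : {finite_measure set X -> \bar R}.

Lemma rintegrable_cst (c : R) : rintegrable mu (cst c).
Proof.
have := finite_measure_integrable_cst mu c.
by move=> h; exact: h.
Qed.

Lemma square_integrable_cst (c : R) : square_integrable mu (cst c).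
Proof. by split=> //; exact: (rintegrable_cst (c ^+ 2)). Qed.

Lemma square_integrable_rintegrable (f : X -> R) :
  square_integrable mu f -> rintegrable mu f.
Proof.
move=> hf; have := square_integrableM hf (square_integrable_cst 1).
by under eq_fun do rewrite mulr1.
Qed.

(** The increments are of order 2^-n in L_2, hence in L_1 since [mu] is finite. Their sum is
    integrable, so finite almost everywhere, and the telescoping series converges absolutely
    there. *)
Lemma ae_cvg_square_integrable (f : nat -> X -> R) :
  (forall n, square_integrable mu (f n)) ->
  (forall n, let e x := f n.+1 x - f n x in inner mu e e <= 4^-1 ^+ n) ->
  {ae mu, forall x, cvgn (f ^~ x)}.
Proof.
move=> hf hfn; pose e n x : R := `|f n.+1 x - f n x|.
pose C : R := (fine (mu setT) + 1) / 2.
have he n : square_integrable mu (fun x => f n.+1 x - f n x).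
  exact: square_integrableB.
have me n : measurable_fun setT (e n).
  by apply: measurableT_comp => //; have [] := he n.
have int_e n : (\int[mu]_x (e n x)%:E <= (C * 2^-1 ^+ n)%:E)%E.
  (* AM-GM with weight 2^n balances the two terms: one integrates to mu(X) 2^-n / 2, the other to at
     most 2^n 4^-n / 2, whence [C]. *)
  pose h x : R := 2^-1 ^+ n / 2 + 2 ^+ n / 2 * (f n.+1 x - f n x) ^+ 2.
  have hh : rintegrable mu h.
    apply: rintegrableD; first exact: rintegrable_cst.
    by apply: rintegrableZ; have [] := he n.
  have eh x : e n x <= h x.
    rewrite /e /h -(real_normK (num_real (_ - _))); set y := `|_|.
    have h2 := sqr_ge0 (2 ^+ n * y - 1).
    have p2 : 0 < 2 ^+ n :> R by rewrite exprn_gt0.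
    rewrite exprVn -(@ler_pM2r _ (2 * 2 ^+ n)) ?mulr_gt0//.
    move: h2 p2; set z := 2 ^+ n => h2 p2.
    have -> : (z^-1 / 2 + z / 2 * y ^+ 2) * (2 * z) = 1 + (z * y) ^+ 2.
      by field; rewrite gt_eqF.
    move: h2; rewrite !expr2; nra.
  apply: (@le_trans _ _ (\int[mu]_x (h x)%:E)%E).
    apply: ge0_le_integral => //.
    - by move=> x _; rewrite lee_fin /e.
    - exact/measurable_EFinP.
    - by case/integrableP : hh.
    - by move=> x _; rewrite lee_fin.
  rewrite -EFin_Rintegral// lee_fin /h RintegralD//; last 2 first.
  - exact: rintegrable_cst.
  - by apply: rintegrableZ; have [] := he n.
  rewrite [X in _ + X]RintegralZl//; last exact: (he n).2.
  rewrite Rintegral_cst//.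
  have -> : \int[mu]_x (f n.+1 x - f n x) ^+ 2 = inner mu (fun x => f n.+1 x - f n x) (fun x => f n.+1 x - f n x).
    by apply: eq_Rintegral => x _; rewrite expr2.
  have := hfn n; set I := inner _ _ _ => /= hI.
  have p2 : 0 < 2 ^+ n :> R by rewrite exprn_gt0.
  have : 2 ^+ n * I <= 2^-1 ^+ n.
    rewrite (le_trans (ler_wpM2l (ltW p2) hI))//.
    by rewrite -exprMn; apply: lerXn2r; rewrite ?nnegrE; lra.
  rewrite /C; nra.
have sum_e : (\int[mu]_x (\sum_(n <oo) (e n x)%:E) < +oo)%E.
  rewrite integral_nneseries//; last 2 first.
  - by move=> n; exact/measurable_EFinP.
  - by move=> n x _; rewrite lee_fin /e.
  apply: (@le_lt_trans _ _ (2 * C)%:E); last exact: ltry.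
  apply: lime_le.
    by apply: is_cvg_nneseries => n _ _; apply: integral_ge0 => x _; rewrite lee_fin /e.
  apply: nearW => n; apply: (@le_trans _ _ (\sum_(0 <= i < n) (C * 2^-1 ^+ i)%:E)%E).
    by apply: lee_sum => i _.
  rewrite sumEFin lee_fin -mulr_sumr mulrC ler_wpM2r//.
    by rewrite /C divr_ge0// addr_ge0// fine_ge0.
  elim: n => [|n IH]; first by rewrite big_geq.
  rewrite (_ : (\sum_(0 <= i < n.+1) _) = 2 - 2 * 2^-1 ^+ n.+1 :> R).
    by rewrite lerBlDr lerDl mulr_ge0// exprn_ge0// invr_ge0.
  elim: n {IH} => [|n IH]; first by rewrite big_nat1 expr0 expr1; field.
  by rewrite big_nat_recr//= IH (exprS _ n.+1); field.
have sum_int : mu.-integrable setT (fun x => \sum_(n <oo) (e n x)%:E)%E.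
  apply/integrableP; split.
    apply: ge0_emeasurable_sum; first by move=> k x _ _; rewrite lee_fin /e.
    by move=> k _; exact/measurable_EFinP.
  rewrite (eq_integral (fun x => \sum_(n <oo) (e n x)%:E)%E)// => x _.
  by rewrite gee0_abs// nneseries_ge0// => n _ _; rewrite lee_fin /e.
have := integrable_ae measurableT sum_int.
apply: filterS => x /= /(_ I) fin.
have : cvgn (series (fun n => f n.+1 x - f n x)).
  apply: normed_cvg.
  have -> : [normed series (fun n => f n.+1 x - f n x)] = series (e ^~ x) by [].
  apply: nondecreasing_is_cvgn.
    by apply/nondecreasing_seqP => n; rewrite !seriesEnat/= big_nat_recr//= lerDl /e.
  exists (fine (\sum_(n <oo) (e n x)%:E)) => _ [n _ <-].
  rewrite -lee_fin fineK// seriesEnat/= -sumEFin.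
  by apply: nneseries_lim_ge => i _ _; rewrite lee_fin /e.
rewrite (telescopeK (f ^~ x)) => h.
suff -> : f ^~ x = [sequence f n x - f 0%N x]_n + cst (f 0%N x).
  by apply: is_cvgD => //; exact: is_cvg_cst.
by apply/funext => n; rewrite fctE/= subrK.
Qed.

(* A Cauchy condition with a geometric rate, which subsequences always satisfy. *)
Lemma square_integrable_complete (f : nat -> X -> R) :
  (forall n, square_integrable mu (f n)) ->
  (forall m n, (n <= m)%N ->
     let e x := f m x - f n x in inner mu e e <= 4^-1 ^+ n) ->
  exists2 g, square_integrable mu g &
    forall n, let e x := g x - f n x in inner mu e e <= 4^-1 ^+ n.
Proof.
move=> hf hfn; have fcvg := ae_cvg_square_integrable hf (fun n => hfn _ _ (leqnSn n)).
(* An upper limit is measurable everywhere, and it equals the limit almost everywhere. *)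
pose g x := fine (limn_esup (fun n => (f n x)%:E)).
have mf n : measurable_fun setT (f n) by have [] := hf n.
have mg : measurable_fun setT g.
  apply: measurableT_comp; first exact: fine_measurable.
  by apply: measurable_fun_limn_esup => n; exact/measurable_EFinP.
have fg : {ae mu, forall x, f ^~ x @ \oo --> g x}.
  apply: filterS fcvg => x /cvg_ex[l fl].
  suff -> : g x = l by [].
  rewrite /g (_ : limn_esup _ = l%:E)//.
  have fl' : (f n x)%:E @[n --> \oo] --> l%:E.
    by apply: cvg_EFin; first exact: nearW.
  by have [_ ->] := cvg_limn_einf_sup fl'.
(* Fatou's lemma along [f (k + n)], as k grows, carries the Cauchy bound over to the limit. *)
have bound n : (\int[mu]_x ((g x - f n x) ^+ 2)%:E <= (4^-1 ^+ n)%:E)%E.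
  pose h k x : \bar R := ((f (k + n)%N x - f n x) ^+ 2)%:E.
  have mh k : measurable_fun setT (h k).
    by apply/measurable_EFinP; apply: measurable_funX; exact: measurable_funB.
  have hgE : {ae mu, forall x, limn_einf (h ^~ x) = ((g x - f n x) ^+ 2)%:E}.
    apply: filterS fg => x fgx.
    have hx : h ^~ x @ \oo --> ((g x - f n x) ^+ 2)%:E.
      apply: cvg_EFin; first exact: nearW.
      have : (f (k + n)%N x - f n x) @[k --> \oo] --> g x - f n x.
        by apply: cvgB; [rewrite (cvg_shiftn n (f ^~ x))|exact: cvg_cst].
      by move=> cv; exact: (cvgM cv cv).
    by have [-> _] := cvg_limn_einf_sup hx.
  rewrite (ae_eq_integral (fun x => limn_einf (h ^~ x)))//; last 3 first.
  - by apply/measurable_EFinP; apply: measurable_funX; exact: measurable_funB.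
  - rewrite /limn_einf; apply: measurableT_comp; first exact: oppe_measurable.
    by apply: measurable_fun_limn_esup => k; apply: measurableT_comp.
  - by apply: filterS hgE => x /= ->.
  apply: (le_trans (fatou mu measurableT mh _)); first by move=> k x _; rewrite lee_fin sqr_ge0.
  rewrite limn_einf_lim; apply: lime_le; first exact: is_cvg_einfs.
  apply: nearW => k; apply: (@le_trans _ _ (\int[mu]_x h k x)%E).
    by apply: ereal_inf_lbound; exists k => /=.
  have hkn := square_integrableB (hf (k + n)%N) (hf n).
  rewrite -(EFin_Rintegral hkn.2) lee_fin; have := hfn _ _ (leq_addl k n).
  by rewrite /inner; under [in X in X -> _]eq_Rintegral do rewrite -expr2.
have gf n : square_integrable mu (fun x => g x - f n x).
  apply: square_integrable_lty; first exact: measurable_funB.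
  by rewrite (le_lt_trans (bound n))// ltry.
exists g.
  by have := square_integrableD (gf 0) (hf 0); under eq_fun do rewrite subrK.
move=> n; cbv zeta; rewrite -lee_fin /inner; under eq_Rintegral do rewrite -expr2.
by rewrite (EFin_Rintegral (gf n).2).
Qed.

End SquareIntegrableComplete.

Section RieszRepresentation.
Context {d} {X : measurableType d} {R : realType}.
Variable mu : {finite_measure set X -> \bar R}.

(* The representing function is the limit of a minimizing sequence of
   [f |-> ||f||^2 - 2 l f], Cauchy by the parallelogram identity. The functional
   is given by its graph [W], a linear subspace. *)
Lemma Riesz_subspace (W : set ((X -> R) * R)) (K : R) :
  0 <= K -> W !=set0 ->
  (forall p, W p -> square_integrable mu p.1) ->
  (forall p p' c, W p -> W p' ->
     W (fun x => p.1 x + c * p'.1 x, p.2 + c * p'.2)) ->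
  (forall p, W p -> p.2 ^+ 2 <= K * inner mu p.1 p.1) ->
  exists2 g, square_integrable mu g & forall p, W p -> inner mu g p.1 = p.2.
Proof.
move=> K0 [p0 Wp0] W2 Wlin WK.
pose J (p : (X -> R) * R) := inner mu p.1 p.1 - 2 * p.2.
(* With N the squared norm of [p.1], AM-GM gives 2 |p.2| <= 2 sqrt (K N) <= K + N. *)
have J_ge p : W p -> - K <= J p.
  move=> Wp; have := WK _ Wp; rewrite /J; have := inner_ge0 mu p.1.
  set N := inner _ _ _ => N0 h; rewrite leNgt; apply/negP => h1.
  have : (K + N) ^+ 2 < (2 * p.2) ^+ 2.
    have hh : K + N < 2 * p.2 by lra.
    by have KN := addr_ge0 K0 N0; rewrite !expr2; nra.
  by have := sqr_ge0 (K - N); rewrite !expr2 in h *; nra.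
have hasinf : has_inf (J @` W).
  by split; [exists (J p0), p0|exists (- K) => _ [p Wp <-]; exact: J_ge].
pose m := inf (J @` W).
have m_le p : W p -> m <= J p by move=> Wp; apply: ge_inf; [exact: hasinf.2|exists p].
(* With this tolerance the parallelogram identity bounds the squared distance between the i-th and
   j-th functions by (4^-i + 4^-j) / 2, which is at most 4^-i for i <= j. *)
have /choice[p Wp] : forall n : nat, exists p, W p /\ J p <= m + 4^-1 ^+ n / 4.
  move=> n; have e0 : 0 < 4^-1 ^+ n / 4 :> R by rewrite divr_gt0// exprn_gt0.
  have [_ [p Wp <-] /ltW Jp] := inf_adherent e0 hasinf.
  by exists p.
have p2 n : square_integrable mu (p n).1 by apply: W2; have [] := Wp n.
have pow_le i j : (i <= j)%N -> 4^-1 ^+ j <= 4^-1 ^+ i :> R.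
  by move=> ij; apply: ler_wiXn2l => //; lra.
have Jcomb q q' t : W q -> W q' -> J (fun x => q.1 x + t * q'.1 x, q.2 + t * q'.2) =
    J q + 2 * t * (inner mu q.1 q'.1 - q'.2) + t ^+ 2 * inner mu q'.1 q'.1.
  move=> Wq Wq'; rewrite /J/= inner_sqr_combination; [ring|exact: W2|exact: W2].
have [g hg gp] : exists2 g, square_integrable mu g &
    forall n, let e x := g x - (p n).1 x in inner mu e e <= 4^-1 ^+ n.
  apply: square_integrable_complete => // i j ij /=.
  have [Wi Ji] := Wp i; have [Wj Jj] := Wp j.
  set D := inner _ _ _.
  have DE : D = inner mu (p i).1 (p i).1 - 2 * inner mu (p i).1 (p j).1 + inner mu (p j).1 (p j).1.
    have -> : D = let e x := (p i).1 x + -1 * (p j).1 x in inner mu e e.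
      by congr inner; apply/funext => x; rewrite mulN1r.
    by rewrite /= inner_sqr_combination//; ring.
  (* [x - x / 2] with [x = p_i + p_j]: [W] is only closed under [p + c p']. *)
  have Wmid := Wlin _ _ (- 2^-1) (Wlin _ _ 1 Wi Wj) (Wlin _ _ 1 Wi Wj).
  have := m_le _ Wmid; rewrite Jcomb; [|exact: Wlin|exact: Wlin].
  rewrite Jcomb//= inner_sqr_combination//.
  have := pow_le _ _ ij; rewrite /J in Ji Jj * => h1 h2; rewrite DE.
  lra.
exists g => // q Wq; have hq := W2 _ Wq.
(* [b1]: moving the near-minimizer along [q] lowers [J] by at most 4^-n / 4, and the discriminant of
   this quadratic in t bounds the defect. [b2]: Cauchy-Schwarz passes from the near-minimizer to
   [g]. *)
have bound n : (inner mu g q.1 - q.2) ^+ 2 <= 4^-1 ^+ n * (4 * inner mu q.1 q.1).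
  have [Wn Jn] := Wp n.
  have N0 := inner_ge0 mu q.1.
  have b1 : (inner mu (p n).1 q.1 - q.2) ^+ 2 <= 4^-1 ^+ n / 4 * inner mu q.1 q.1.
    apply: discriminant_le => // t.
    have := m_le _ (Wlin _ _ t Wn Wq); rewrite Jcomb//; lra.
  have hgp := square_integrableB hg (p2 n).
  have := Cauchy_Schwarz hgp hq; rewrite innerBl//.
  have := gp n => /=; set D := inner mu (fun x => _) _ => hD h.
  have b2 : (inner mu g q.1 - inner mu (p n).1 q.1) ^+ 2 <= 4^-1 ^+ n * inner mu q.1 q.1.
    by rewrite (le_trans h)// ler_wpM2r.
  have e0 : 0 <= 4^-1 ^+ n :> R by rewrite exprn_ge0.
  have eN := mulr_ge0 e0 N0.
  have := sqr_ge0 ((inner mu g q.1 - inner mu (p n).1 q.1) - (inner mu (p n).1 q.1 - q.2)).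
  rewrite !expr2 in b1 b2 *; nra.
apply/eqP; rewrite -subr_eq0 -sqrf_eq0 eq_le sqr_ge0 andbT.
have cv : (4^-1 ^+ n * (4 * inner mu q.1 q.1)) @[n --> \oo] --> (0 : R).
  rewrite -[X in _ --> X](mul0r (4 * inner mu q.1 q.1)); apply: cvgM; last exact: cvg_cst.
  apply: cvg_expr; rewrite ger0_norm; lra.
have := cvg_lim _ cv => <-//.
by apply: limr_ge; [apply/cvg_ex; exists 0|exact: nearW].
Qed.

End RieszRepresentation.

(** * Weighted integrals, Fubini and densities *)

Section WeightedCauchySchwarz.
Context {d} {X : measurableType d} {R : realType}.
Variable mu : {measure set X -> \bar R}.
Implicit Types f w : X -> R.

(** Obtained from the quadratic t |-> int (f + t)^2 w; integrability of f w follows from |f| <= f^2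
    + 1. It is applied to the sections of a joint density in either variable. *)
Lemma weighted_Cauchy_Schwarz f w : measurable_fun setT f ->
  (forall x, 0 <= w x) -> rintegrable mu w ->
  rintegrable mu (fun x => f x ^+ 2 * w x) ->
  rintegrable mu (fun x => f x * w x) /\
  (\int[mu]_x (f x * w x)) ^+ 2 <=
    \int[mu]_x (f x ^+ 2 * w x) * \int[mu]_x w x.
Proof.
move=> mf w0 iw if2w; have mw := rintegrable_measurable iw.
have ifw : rintegrable mu (fun x => f x * w x).
  apply: le_rintegrable (rintegrableD if2w iw); first exact: measurable_funM.
  move=> x; have := w0 x => w0x; rewrite normrM (ger0_norm w0x).
  have -> : f x ^+ 2 * w x + w x = (f x ^+ 2 + 1) * w x by ring.
  rewrite ler_wpM2r//.
  by rewrite -[f x ^+ 2]real_normK ?num_real//; have := normr_ge0 (f x); nra.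
split=> //; apply: discriminant_le; first by apply: Rintegral_ge0.
move=> t; rewrite -!RintegralZl// -RintegralD//; last exact: rintegrableZ.
rewrite -RintegralD//; last 2 first.
- by apply: rintegrableD => //; exact: rintegrableZ.
- exact: rintegrableZ.
apply: Rintegral_ge0 => x _.
have -> : f x ^+ 2 * w x + 2 * t * (f x * w x) + t ^+ 2 * w x =
  (f x + t) ^+ 2 * w x by ring.
by rewrite mulr_ge0// sqr_ge0.
Qed.

End WeightedCauchySchwarz.

Section RealFubini.
Context {d1 d2} {X : measurableType d1} {Y : measurableType d2} {R : realType}.
Variables (mu : {sigma_finite_measure set X -> \bar R})
  (nu : {sigma_finite_measure set Y -> \bar R}).
Implicit Types f : X * Y -> R.

Lemma measurable_section_r f x :
  measurable_fun setT f -> measurable_fun setT (fun y => f (x, y)).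
Proof. by move=> mf; apply: measurableT_comp. Qed.

(** The integral is by definition the difference of those of the positive and negative parts, and
    each of these is measurable in y by Tonelli. *)
Lemma measurable_Rintegral_l f : measurable_fun setT f ->
  measurable_fun setT (fun y => \int[mu]_x f (x, y)).
Proof.
move=> mf; apply: measurableT_comp; first exact: fine_measurable.
rewrite (_ : (fun _ => _) = ((fun y => \int[mu]_x ((EFin \o f)^\+ (x, y))) \-
  (fun y => \int[mu]_x ((EFin \o f)^\- (x, y))))%E).
  apply: emeasurable_funB.
  - apply: measurable_fun_fubini_tonelli_G => //.
    by apply: measurable_funepos; exact/measurable_EFinP.
  - apply: measurable_fun_fubini_tonelli_G => //.
    by apply: measurable_funeneg; exact/measurable_EFinP.
by apply/funext => y; rewrite [LHS]integralE /=; congr (_ - _)%E;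
  apply: eq_integral => t _; rewrite !(funeposE, funenegE).
Qed.

Lemma measurable_Rintegral_r f : measurable_fun setT f ->
  measurable_fun setT (fun x => \int[nu]_y f (x, y)).
Proof.
move=> mf; apply: measurableT_comp; first exact: fine_measurable.
rewrite (_ : (fun _ => _) = ((fun x => \int[nu]_y ((EFin \o f)^\+ (x, y))) \-
  (fun x => \int[nu]_y ((EFin \o f)^\- (x, y))))%E).
  apply: emeasurable_funB.
  - apply: measurable_fun_fubini_tonelli_F => //.
    by apply: measurable_funepos; exact/measurable_EFinP.
  - apply: measurable_fun_fubini_tonelli_F => //.
    by apply: measurable_funeneg; exact/measurable_EFinP.
by apply/funext => x; rewrite [LHS]integralE /=; congr (_ - _)%E;
  apply: eq_integral => t _; rewrite !(funeposE, funenegE).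
Qed.

Lemma rintegrable_Rintegral_l f : rintegrable (mu \x nu)%E f ->
  rintegrable nu (fun y => \int[mu]_x f (x, y)).
Proof.
move=> hf; have mf := rintegrable_measurable hf.
have mF := measurable_Rintegral_l mf.
apply/integrableP; split; first exact/measurable_EFinP.
have mef : measurable_fun setT (EFin \o f) by exact/measurable_EFinP.
apply: le_lt_trans ((integrable21ltyP mu nu mef).1 hf).
apply: ae_ge0_le_integral => //.
- by apply: measurableT_comp => //; exact/measurable_EFinP.
- by move=> y _; apply: integral_ge0.
- apply: (measurable_fun_fubini_tonelli_G (fun p => `|(f p)%:E|%E)) => //.
  exact: measurableT_comp.
- have := ae_integrable2 hf; apply: filterS => y ify _.
  rewrite abse_EFin EFin_normr_Rintegral//.
  by apply: le_abse_integral => //; case/integrableP : ify.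
Qed.

Lemma rintegrable_Rintegral_r f : rintegrable (mu \x nu)%E f ->
  rintegrable mu (fun x => \int[nu]_y f (x, y)).
Proof.
move=> hf; have mf := rintegrable_measurable hf.
have mF := measurable_Rintegral_r mf.
apply/integrableP; split; first exact/measurable_EFinP.
have mef : measurable_fun setT (EFin \o f) by exact/measurable_EFinP.
apply: le_lt_trans ((integrable12ltyP mu nu mef).1 hf).
apply: ae_ge0_le_integral => //.
- by apply: measurableT_comp => //; exact/measurable_EFinP.
- by move=> y _; apply: integral_ge0.
- apply: (measurable_fun_fubini_tonelli_F (fun p => `|(f p)%:E|%E)) => //.
  exact: measurableT_comp.
- have := ae_integrable1 hf; apply: filterS => x ifx _.
  rewrite abse_EFin EFin_normr_Rintegral//.
  by apply: le_abse_integral => //; case/integrableP : ifx.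
Qed.

Lemma Rintegral_Fubini f : rintegrable (mu \x nu)%E f ->
  \int[mu]_x (\int[nu]_y f (x, y)) = \int[nu]_y (\int[mu]_x f (x, y)).
Proof.
move=> hf; have mf := rintegrable_measurable hf.
congr fine.
(* The real inner integral may differ from the extended one where the section is not integrable,
   because [fine] sends infinities to 0; these sections form a null set. *)
rewrite (ae_eq_integral (fun x => \int[nu]_y (f (x, y))%:E)%E)//; first last.
- have := ae_integrable1 hf; apply: filterS => x ifx _.
  by rewrite EFin_Rintegral.
- exact: (measurable_fubini_F hf).
- by apply/measurable_EFinP; exact: measurable_Rintegral_r.
rewrite [RHS](ae_eq_integral (fun y => \int[mu]_x (f (x, y))%:E)%E)//; first last.
- have := ae_integrable2 hf; apply: filterS => y ify _.
  by rewrite EFin_Rintegral.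
- exact: (measurable_fubini_G hf).
- by apply/measurable_EFinP; exact: measurable_Rintegral_l.
exact: (Fubini hf).
Qed.

End RealFubini.

Section Density.
Context {d} {Y : measurableType d} {R : realType}.
Variables (P lam : {measure set Y -> \bar R}) (dens : Y -> R).
Hypotheses (mdens : measurable_fun setT dens) (dens0 : forall y, 0 <= dens y).
Hypothesis P_dens :
  forall A, measurable A -> P A = (\int[lam]_(y in A) (dens y)%:E)%E.

Import HBNNSimple.

(** The hypothesis [P_dens] is the case of indicators; it extends to simple functions by additivity
    and to the limit by monotone convergence. *)
Lemma ge0_integral_density (f : Y -> \bar R) :
  measurable_fun setT f -> (forall y, 0 <= f y)%E ->
  (\int[P]_y f y = \int[lam]_y (f y * (dens y)%:E))%E.
Proof.
move=> mf f0; pose h := nnsfun_approx measurableT mf.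
have hcvg y : (EFin \o h n) y @[n --> \oo] --> f y by exact: cvg_nnsfun_approx.
have h_dens0 n y : (0 <= (h n y)%:E * (dens y)%:E)%E.
  by rewrite mule_ge0 ?lee_fin.
have mdensE : measurable_fun setT (EFin \o dens) by exact/measurable_EFinP.
have -> : (\int[P]_y f y = limn (fun n => \int[P]_y (h n y)%:E))%E.
  rewrite -monotone_convergence//.
  - by apply: eq_integral => y _; apply/esym/cvg_lim => //; exact: hcvg.
  - by move=> n; exact/measurable_EFinP.
  - by move=> n y _; rewrite lee_fin.
  - by move=> y _ a b ab; rewrite lee_fin; exact/lefP/nd_nnsfun_approx.
have -> : (\int[lam]_y (f y * (dens y)%:E) =
    limn (fun n => \int[lam]_y ((h n y)%:E * (dens y)%:E)))%E.
  rewrite -monotone_convergence//.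
  - apply: eq_integral => y _; apply/esym/cvg_lim => //.
    by apply: cvgeZr => //; exact: hcvg.
  - by move=> n; apply: emeasurable_funM => //; exact/measurable_EFinP.
  - move=> y _ a b ab; rewrite lee_wpmul2r ?lee_fin//.
    exact/lefP/nd_nnsfun_approx.
congr (limn _); apply/funext => n.
transitivity (\int[P]_y
   (\sum_(r \in range (h n)) (r * \1_(h n @^-1` [set r]) y)%:E))%E.
  by apply: eq_integral => y _; rewrite /= fimfunE -fsumEFin.
have mindic r : measurable_fun setT (fun y => (r * \1_(h n @^-1` [set r]) y)%:E).
  by apply/measurable_EFinP; exact: measurable_funM.
rewrite ge0_integral_fsum//; last by move=> r y _; exact: nnfun_muleindic_ge0.
transitivity (\int[lam]_y (\sum_(r \in range (h n))
    (r * \1_(h n @^-1` [set r]) y)%:E * (dens y)%:E))%E; last first.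
  apply: eq_integral => y _.
  rewrite -ge0_mule_fsuml => [|r]; last exact: nnfun_muleindic_ge0.
  by rewrite fsumEFin // -(fimfunE _ y).
rewrite ge0_integral_fsum//; last 2 first.
  - by move=> r; apply: emeasurable_funM.
  - by move=> r y _; rewrite mule_ge0 ?lee_fin// -lee_fin nnfun_muleindic_ge0.
apply: eq_fsbigr => r rhn.
under eq_integral do rewrite EFinM.
rewrite integralZl_indic_nnsfun => //.
under [RHS]eq_integral do rewrite EFinM -muleA.
rewrite ge0_integralZl//.
- under [in RHS]eq_integral do rewrite muleC.
  rewrite [in RHS](eq_integral ((EFin \o dens) \_ (h n @^-1` [set r]))); last first.
    by move=> y _; rewrite epatch_indic.
  by rewrite -integral_mkcond integral_indic// setIT P_dens.
- by apply: emeasurable_funM => //; exact/measurable_EFinP.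
- by move=> y _; rewrite mule_ge0 ?lee_fin.
- by move: rhn; rewrite inE => -[t _ <-]; rewrite lee_fin.
Qed.

Lemma ge0_Rintegral_density (f : Y -> R) : (forall y, 0 <= f y) ->
  measurable_fun setT f ->
  \int[P]_y f y = \int[lam]_y (f y * dens y).
Proof.
move=> f0 mf; congr fine.
rewrite ge0_integral_density; [|exact/measurable_EFinP|by move=> y; rewrite lee_fin].
by apply: eq_integral => y _; rewrite EFinM.
Qed.

Lemma rintegrable_density (f : Y -> R) :
  rintegrable P f -> rintegrable lam (fun y => f y * dens y).
Proof.
move=> /integrableP[/measurable_EFinP mf foo]; apply/integrableP; split.
  by apply/measurable_EFinP; exact: measurable_funM.
move: foo; rewrite ge0_integral_density//; last first.
  by apply: measurableT_comp => //; exact/measurable_EFinP.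
by congr (_ < _)%E; apply: eq_integral => y _; rewrite /= normrM (ger0_norm (dens0 _)).
Qed.

Lemma Rintegral_density (f : Y -> R) :
  rintegrable P f -> \int[P]_y f y = \int[lam]_y (f y * dens y).
Proof.
move=> hf; have mf := rintegrable_measurable hf.
have hn : rintegrable P (fun y => `|f y|).
  exact: integrable_norm.
have hs := rintegrableD hn hf.
(* A difference of two nonnegative functions, to which the nonnegative case applies. *)
have -> : \int[P]_y f y = \int[P]_y (`|f y| + f y) - \int[P]_y `|f y|.
  by rewrite RintegralD// addrAC subrr add0r.
have mn : measurable_fun setT (fun y => `|f y|) by exact: measurableT_comp.
have s0 y : 0 <= `|f y| + f y by rewrite addrC -lerBlDr sub0r lerNl -normrN ler_norm.
rewrite (ge0_Rintegral_density s0); last exact: measurable_funD.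
rewrite (@ge0_Rintegral_density (fun y => `|f y|))//.
rewrite -RintegralB//; try exact: rintegrable_density.
by apply: eq_Rintegral => y _; ring.
Qed.


Lemma ae_density (Q : set Y) :
  {ae lam, forall y, Q y} -> {ae P, forall y, Q y}.
Proof.
move=> [N [mN N0 QN]]; exists N; split => //; rewrite P_dens//.
by apply: null_set_integral => //; exact/measurable_funTS/measurable_EFinP.
Qed.

End Density.

(** * Adjoint of the score operator *)

(* [q] is the density of the joint law of (x, y) with respect to [eta \x lam];
   only its [y]-marginal [P] is a probability, the [x]-marginal being merely
   dominated by [M * eta]. *)
Section InformationOperator.
Context {d1 d2} {X : measurableType d1} {Y : measurableType d2} {R : realType}.
Variables (eta : probability X R)
  (lam : {sigma_finite_measure set Y -> \bar R}) (P : probability Y R).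
Variables (q : X * Y -> R) (M : R).
Hypotheses (mq : measurable_fun setT q) (q0 : forall p, 0 <= q p).
Hypothesis q_le : forall x, (\int[lam]_y (q (x, y))%:E <= M%:E)%E.

Definition marginal y := \int[eta]_x q (x, y).

Hypothesis P_marginal :
  forall A, measurable A -> P A = (\int[lam]_(y in A) (marginal y)%:E)%E.

(** The conditional expectation of b(x) given y under the joint law; it is 0 where the marginal
    vanishes, since division by 0 gives 0. *)
Definition posterior (b : X -> R) y :=
  (\int[eta]_x (b x * q (x, y))) / marginal y.

Definition centered_posterior b y := posterior b y - \int[P]_y posterior b y.

Definition adjoint (g : Y -> R) x := \int[lam]_y (g y * q (x, y)).

Let measurable_marginal : measurable_fun setT marginal.
Proof. exact: measurable_Rintegral_l. Qed.

Let marginal_ge0 y : 0 <= marginal y.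
Proof. by apply: Rintegral_ge0. Qed.

Let M_ge0 : 0 <= M.
Proof.
rewrite -lee_fin; apply: le_trans (q_le point).
by apply: integral_ge0 => y _; rewrite lee_fin.
Qed.

(** Integrating over y first costs at most the factor [M]. *)
Lemma rintegrable_fst_joint (k : X -> R) : (forall x, 0 <= k x) ->
  rintegrable eta k -> rintegrable (eta \x lam)%E (fun p => k p.1 * q p).
Proof.
move=> k0 ik; have mk := rintegrable_measurable ik.
have mkq : measurable_fun setT (fun p : X * Y => k p.1 * q p).
  by apply: measurable_funM => //; exact: measurableT_comp.
apply/integrable12ltyP; first exact/measurable_EFinP.
have mqx x : measurable_fun setT (fun y => (q (x, y))%:E).
  by apply/measurable_EFinP; exact: measurable_section_r.
apply: (@le_lt_trans _ _ (\int[eta]_x (M * k x)%:E)%E).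
  apply: ge0_le_integral => //.
  - by move=> x _; apply: integral_ge0.
  - apply: (measurable_fun_fubini_tonelli_F (fun p => `|(k p.1 * q p)%:E|%E)) => //.
    by apply: measurableT_comp => //; exact/measurable_EFinP.
  - by apply/measurable_EFinP; exact: measurable_funM.
  - move=> x _; under eq_integral do rewrite /= ger0_norm ?mulr_ge0// EFinM.
    rewrite ge0_integralZl//; last 2 first.
    + by move=> y _; rewrite lee_fin.
    + by rewrite lee_fin.
    by rewrite mulrC EFinM lee_wpmul2l ?lee_fin.
by rewrite -EFin_Rintegral ?ltry//; exact: rintegrableZ.
Qed.

Lemma rintegrable_joint : rintegrable (eta \x lam)%E q.
Proof.
have := rintegrable_fst_joint (fun=> ler01) (rintegrable_cst eta 1).
by under eq_fun do rewrite mul1r.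
Qed.

Lemma ae_rintegrable_section :
  {ae lam, forall y, rintegrable eta (fun x => q (x, y))}.
Proof. exact: ae_integrable2 rintegrable_joint. Qed.

(** Integrating over x first turns q into [marginal], the density of [P]. *)
Lemma rintegrable_snd_joint (k : Y -> R) : (forall y, 0 <= k y) ->
  rintegrable P k -> rintegrable (eta \x lam)%E (fun p => k p.2 * q p).
Proof.
move=> k0 ik; have mk := rintegrable_measurable ik.
have mkq : measurable_fun setT (fun p : X * Y => k p.2 * q p).
  by apply: measurable_funM => //; exact: measurableT_comp.
apply/integrable21ltyP; first exact/measurable_EFinP.
rewrite (ae_eq_integral (fun y => (k y * marginal y)%:E)%E)//.
- rewrite -EFin_Rintegral ?ltry//.
  exact: (rintegrable_density measurable_marginal marginal_ge0 P_marginal ik).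
- apply: (measurable_fun_fubini_tonelli_G (fun p => `|(k p.2 * q p)%:E|%E)) => //.
  by apply: measurableT_comp => //; exact/measurable_EFinP.
- by apply/measurable_EFinP; exact: measurable_funM.
have := ae_rintegrable_section; apply: filterS => y iq _.
under eq_integral do rewrite /= ger0_norm ?mulr_ge0// EFinM.
rewrite ge0_integralZl//.
- by rewrite -EFin_Rintegral// EFinM.
- by case/integrableP : iq.
- by move=> x _; rewrite lee_fin.
- by rewrite lee_fin.
Qed.

Let measurable_fstM (b : X -> R) : measurable_fun setT b ->
  measurable_fun setT (fun p : X * Y => b p.1 * q p).
Proof. by move=> mb; apply: measurable_funM => //; exact: measurableT_comp. Qed.

Let measurable_sndM (g : Y -> R) : measurable_fun setT g ->
  measurable_fun setT (fun p : X * Y => g p.2 * q p).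
Proof. by move=> mb; apply: measurable_funM => //; exact: measurableT_comp. Qed.

Lemma measurable_posterior b : measurable_fun setT b ->
  measurable_fun setT (posterior b).
Proof.
move=> mb; apply: measurable_funM.
  exact: (@measurable_Rintegral_l _ _ _ _ _ _ (fun p => b p.1 * q p) (measurable_fstM mb)).
(* On nonnegative reals, 0 included, the inverse is the power -1, which is measurable. *)
rewrite (_ : (fun _ => _) = (fun y => marginal y `^ (-1))).
  exact: (measurableT_comp (measurable_powR _)).
by apply/funext => y; rewrite powR_inv1.
Qed.

Lemma measurable_adjoint g : measurable_fun setT g ->
  measurable_fun setT (adjoint g).
Proof. by move=> mg; exact: (@measurable_Rintegral_r _ _ _ _ _ _ (fun p => g p.2 * q p) (measurable_sndM mg)). Qed.

Lemma rintegrable_sqr_fst_joint b : square_integrable eta b ->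
  rintegrable (eta \x lam)%E (fun p => b p.1 ^+ 2 * q p).
Proof.
move=> hb; apply: (rintegrable_fst_joint (k := fun x => b x ^+ 2)) hb.2.
by move=> x; rewrite sqr_ge0.
Qed.

Lemma rintegrable_sqr_snd_joint g : square_integrable P g ->
  rintegrable (eta \x lam)%E (fun p => g p.2 ^+ 2 * q p).
Proof.
move=> hg; apply: (rintegrable_snd_joint (k := fun x => g x ^+ 2)) hg.2.
by move=> y; rewrite sqr_ge0.
Qed.

(** Conditional Jensen inequality, from Cauchy-Schwarz with weight q(., y). Where the marginal is 0,
    Cauchy-Schwarz also forces the numerator of [posterior] to be 0, so the convention for division
    by 0 does no harm. *)
Lemma ae_posterior_le b : square_integrable eta b ->
  {ae lam, forall y, [/\ rintegrable eta (fun x => b x * q (x, y)),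
    posterior b y * marginal y = \int[eta]_x (b x * q (x, y)) &
    posterior b y ^+ 2 * marginal y <= \int[eta]_x (b x ^+ 2 * q (x, y))]}.
Proof.
move=> hb; have i2 := ae_integrable2 (rintegrable_sqr_fst_joint hb).
apply: filterS2 ae_rintegrable_section i2 => y iq ib2.
have [ibq CS] := weighted_Cauchy_Schwarz hb.1 (fun x => q0 (x, y)) iq ib2.
split=> //; rewrite /posterior -/(marginal y) in CS *;
    have [m0|m0] := eqVneq (marginal y) 0.
- move: CS; rewrite !m0 !mulr0 => /(conj (sqr_ge0 (\int[eta]_x (b x * q (x, y))))).
  by move=> /andP; rewrite -eq_le eq_sym sqrf_eq0 => /eqP.
- by rewrite divfK.
- by rewrite m0 mulr0; apply: Rintegral_ge0 => x _; rewrite mulr_ge0// sqr_ge0.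
- have mgt0 : 0 < marginal y by rewrite lt_neqAle eq_sym m0 marginal_ge0.
  rewrite expr_div_n expr2 [marginal y ^+ 2]expr2 invfM mulrA -!mulrA mulVf// mulr1.
  by rewrite mulrA -expr2 ler_pdivrMr.
Qed.

Lemma square_integrable_posterior b : square_integrable eta b ->
  square_integrable P (posterior b).
Proof.
move=> hb; have mp := measurable_posterior hb.1.
apply: square_integrable_lty => //.
rewrite (ge0_integral_density measurable_marginal marginal_ge0 P_marginal); last 2 first.
- by apply/measurable_EFinP; exact: measurable_funX.
- by move=> y; rewrite lee_fin sqr_ge0.
have hI := rintegrable_Rintegral_l (rintegrable_sqr_fst_joint hb).
apply: (@le_lt_trans _ _ (\int[lam]_y (\int[eta]_x (b x ^+ 2 * q (x, y)))%:E)%E).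
  apply: ae_ge0_le_integral => //.
  - by move=> y _; rewrite mule_ge0 ?lee_fin ?sqr_ge0.
  - apply: emeasurable_funM; apply/measurable_EFinP => //.
    exact: measurable_funX.
  - move=> y _; rewrite lee_fin; apply: Rintegral_ge0 => x _.
    by rewrite mulr_ge0// sqr_ge0.
  - by apply/measurable_EFinP; exact: rintegrable_measurable hI.
  - have := ae_posterior_le hb; apply: filterS => y [_ _ le_y] _.
    by rewrite -EFinM lee_fin.
by rewrite -EFin_Rintegral// ltry.
Qed.

Lemma posteriorD b b' c : square_integrable eta b -> square_integrable eta b' ->
  {ae P, forall y, posterior (fun x => b x + c * b' x) y =
                   posterior b y + c * posterior b' y}.
Proof.
move=> hb hb'; apply: (ae_density measurable_marginal P_marginal).
apply: filterS2 (ae_posterior_le hb) (ae_posterior_le hb') => y [ib _ _] [ib' _ _].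
rewrite /posterior mulrA -mulrDl; congr (_ / _).
rewrite -RintegralZl// -RintegralD//; last exact: rintegrableZ.
by apply: eq_Rintegral => x _; rewrite mulrDl mulrA.
Qed.

(** Cauchy-Schwarz with weight q(x, .), of total mass at most [M], bounds the square of [adjoint g]
    at x by M times the integral of g^2 q(x, .). *)
Lemma square_integrable_adjoint g : square_integrable P g ->
  square_integrable eta (adjoint g).
Proof.
move=> hg; have mp := measurable_adjoint hg.1.
apply: square_integrable_lty => //.
have hI := rintegrable_Rintegral_r (rintegrable_sqr_snd_joint hg).
apply: (@le_lt_trans _ _ (\int[eta]_x (M * \int[lam]_y (g y ^+ 2 * q (x, y)))%:E)%E).
  apply: ae_ge0_le_integral => //.
  - by move=> x _; rewrite lee_fin sqr_ge0.
  - by apply/measurable_EFinP; exact: measurable_funX.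
  - move=> x _; rewrite lee_fin mulr_ge0//; apply: Rintegral_ge0 => y _.
    by rewrite mulr_ge0// sqr_ge0.
  - by apply/measurable_EFinP; apply: measurable_funM => //; exact: rintegrable_measurable hI.
  - apply: filterS2 (ae_integrable1 rintegrable_joint)
      (ae_integrable1 (rintegrable_sqr_snd_joint hg)) => x iq ig2 _.
    have [_ CS] := weighted_Cauchy_Schwarz hg.1 (fun y => q0 (x, y)) iq ig2.
    rewrite lee_fin (le_trans CS)// mulrC ler_wpM2r//.
      by apply: Rintegral_ge0 => y _; rewrite mulr_ge0// sqr_ge0.
    by rewrite -lee_fin EFin_Rintegral.
by rewrite -EFin_Rintegral ?ltry//; exact: rintegrableZ.
Qed.

(** Both sides are the double integral of g(y) b(x) q(x, y), which converges absolutely because |g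
    b| <= b^2 + g^2. *)
Lemma inner_posterior_adjoint b g :
  square_integrable eta b -> square_integrable P g ->
  inner P g (posterior b) = inner eta (adjoint g) b.
Proof.
move=> hb hg; have hp := square_integrable_posterior hb.
have igp := square_integrableM hg hp.
rewrite /inner (Rintegral_density measurable_marginal marginal_ge0 P_marginal igp).
have ib2 := rintegrable_sqr_fst_joint hb.
have ig2 := rintegrable_sqr_snd_joint hg.
have mgbq : measurable_fun setT (fun p : X * Y => g p.2 * (b p.1 * q p)).
  apply: measurable_funM; last exact: measurable_fstM hb.1.
  exact: (measurableT_comp hg.1).
have igbq : rintegrable (eta \x lam)%E (fun p => g p.2 * (b p.1 * q p)).
  apply: le_rintegrable (rintegrableD ib2 ig2) => // p.
  rewrite -mulrDl mulrA normrM (ger0_norm (q0 _)) ler_wpM2r//.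
  by rewrite ler_norml; apply/andP; split; nra.
transitivity (\int[lam]_y (\int[eta]_x (g y * (b x * q (x, y))))).
  apply: ae_eq_Rintegral.
  - apply: measurable_funM => //; apply: measurable_funM; [exact: hg.1|exact: hp.1].
  - exact: rintegrable_measurable (rintegrable_Rintegral_l igbq).
  - have := ae_posterior_le hb; apply: filterS => y [ib eq_y _].
    by rewrite -mulrA eq_y -RintegralZl.
rewrite -(Rintegral_Fubini igbq); apply: ae_eq_Rintegral.
- exact: rintegrable_measurable (rintegrable_Rintegral_r igbq).
- by apply: measurable_funM; [exact: measurable_adjoint hg.1|exact: hb.1].
apply: filterS2 (ae_integrable1 rintegrable_joint) (ae_integrable1 ig2) => x iq igx.
have [ig _] := weighted_Cauchy_Schwarz hg.1 (fun y => q0 (x, y)) iq igx.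
rewrite mulrC -RintegralZl//; apply: eq_Rintegral => y _; ring.
Qed.

(** Once the posterior is moved across the inner product, r - E r - [adjoint g1] is orthogonal to
    [V], and density of [V] among mean-zero functions leaves only a constant. Square integrability
    of g against almost every section of q is Tonelli applied to g in L_2(P). *)
Lemma adjoint_representation (V : set (X -> R)) (r : X -> R) (K : R) :
  (forall b, V b -> square_integrable eta b) ->
  (forall b b' c, V b -> V b' -> V (fun x => b x + c * b' x)) ->
  (forall g, square_integrable eta g -> \int[eta]_x g x = 0 ->
     forall e, 0 < e -> exists2 b, V b &
       let k x := g x - b x in inner eta k k < e) ->
  square_integrable eta r -> 0 <= K ->
  (forall b, V b ->
     inner eta (fun x => r x - \int[eta]_x r x) b ^+ 2 <=
     K * inner P (centered_posterior b) (centered_posterior b)) ->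
  exists (c : R) (g : Y -> R), measurable_fun setT g /\
    {ae eta, forall x, rintegrable lam (fun y => g y ^+ 2 * q (x, y)) /\
       r x = c + adjoint g x}.
Proof.
move=> V2 Vlin Vdense hr K0 VK.
set phi := \int[eta]_x r x in VK.
have hrphi : square_integrable eta (fun x => r x - phi).
  exact: square_integrableB hr (square_integrable_cst eta phi).
have hcp b : V b -> square_integrable P (centered_posterior b).
  move=> Vb; apply: square_integrableB (square_integrable_posterior (V2 _ Vb)) _.
  exact: square_integrable_cst.
have rp b : V b -> rintegrable P (posterior b).
  by move=> /V2 /square_integrable_posterior /square_integrable_rintegrable.
(* Equality is only required almost everywhere, because [posterior] is linear only almost everywhere
   and [W] must be closed under combinations. *)
pose W (p : (Y -> R) * R) := exists b, [/\ V b, square_integrable P p.1,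
  {ae P, forall y, p.1 y = centered_posterior b y} &
  p.2 = inner eta (fun x => r x - phi) b].
have [g hg gW] : exists2 g, square_integrable P g &
    forall p, W p -> inner P g p.1 = p.2.
  apply: (Riesz_subspace (K := K)) => //.
  - have [|b Vb _] := Vdense (cst 0) (square_integrable_cst _ _) _ 1 ltr01.
      by rewrite Rintegral_cst// mul0r.
    exists (centered_posterior b, inner eta (fun x => r x - phi) b).
    by exists b; split => //; [exact: hcp|exact: aeW].
  - by move=> p [b []].
  - move=> [f l] [f' l'] c [b [Vb hf fb /= ->]] [b' [Vb' hf' fb' /= ->]].
    have Vbb' := Vlin _ _ c Vb Vb'.
    exists (fun x => b x + c * b' x); split; [exact: Vbb'| | |] => /=.
    + by apply: square_integrableD => //; exact: square_integrableZ.
    + have pD := posteriorD c (V2 _ Vb) (V2 _ Vb').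
      have iD : \int[P]_y posterior (fun x => b x + c * b' x) y =
          \int[P]_y posterior b y + c * \int[P]_y posterior b' y.
        rewrite -RintegralZl//; last exact: rp.
        rewrite -RintegralD//; [|exact: rp|by apply: rintegrableZ; exact: rp].
        apply: ae_eq_Rintegral pD; first exact: measurable_posterior (V2 _ Vbb').1.
        apply: measurable_funD; first exact: measurable_posterior (V2 _ Vb).1.
        by apply: measurable_funM => //; exact: measurable_posterior (V2 _ Vb').1.
      apply: filterS3 fb fb' pD => y /= -> -> pDy.
      by rewrite /centered_posterior pDy iD; ring.
    + rewrite innerDr//; [|exact: V2|by apply: square_integrableZ; exact: V2].
      by rewrite innerZr//; exact: V2.
  - move=> [f l] [b [Vb hf fb /= ->]]; rewrite (le_trans (VK _ Vb))//.
    rewrite le_eqVlt; apply/orP; left; apply/eqP; congr (_ * _).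
    have mc := (hcp _ Vb).1; have mf := hf.1.
    apply: ae_eq_Rintegral; [exact: measurable_funM|exact: measurable_funM|].
    by apply: filterS fb => y /= ->.
(* Centering is self-adjoint: pairing g with a centered posterior amounts to pairing the centered g
   with the posterior itself. *)
pose g1 y := g y - \int[P]_y g y.
have hg1 : square_integrable P g1.
  exact: square_integrableB hg (square_integrable_cst P _).
have gb b : V b -> inner eta (adjoint g1) b = inner eta (fun x => r x - phi) b.
  move=> Vb; rewrite -inner_posterior_adjoint//; last exact: V2.
  have hpb := square_integrable_posterior (V2 _ Vb).
  have hc := @square_integrable_cst _ _ _ P.
  have ig := square_integrable_rintegrable hg.
  have <- : inner P g (centered_posterior b) = inner eta (fun x => r x - phi) b.
    apply: (gW (centered_posterior b, _)); exists b; split => //; last exact: aeW.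
    exact: hcp.
  rewrite (innerBl hg (hc _) hpb) (innerBr hpb (hc _) hg) /inner; congr (_ - _).
  by rewrite RintegralZl ?RintegralZr//; exact: rp.
have hadj := square_integrable_adjoint hg1.
pose w x := (r x - phi) - adjoint g1 x.
have hw : square_integrable eta w by exact: square_integrableB.
have wV b : V b -> inner eta w b = 0.
  by move=> Vb; rewrite innerBl ?gb ?subrr//; exact: V2.
(* Density concerns mean-zero functions only, so it is the centered [w] that is shown to vanish. *)
pose m := \int[eta]_x w x.
pose w0 x := w x - m.
have hw0 : square_integrable eta w0.
  exact: square_integrableB hw (square_integrable_cst eta m).
have iw := square_integrable_rintegrable hw.
have int_w0 : \int[eta]_x w0 x = 0.
  rewrite RintegralB//; last exact: rintegrable_cst.
  rewrite Rintegral_cst// (_ : fine _ = 1) ?mulr1 ?subrr//.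
  by rewrite [X in fine X](_ : _ = 1%E)//; exact: (probability_setT eta).
have w0w : inner eta w0 w0 = inner eta w w0.
  rewrite {1}/w0 innerBl//; last exact: square_integrable_cst.
  rewrite [X in _ - X](_ : _ = 0) ?subr0// /inner RintegralZl ?int_w0 ?mulr0//.
  exact: square_integrable_rintegrable.
(* For b in [V], <w0, w0> = <w, w0> = <w, w0 - b>, and b can be taken close to [w0]. *)
have w0e e : 0 < e -> inner eta w0 w0 ^+ 2 <= inner eta w w * e.
  move=> e0; have [b Vb /= hb] := Vdense _ hw0 int_w0 e e0.
  have hwb := square_integrableB hw0 (V2 _ Vb).
  have -> : inner eta w0 w0 = inner eta w (fun x => w0 x - b x).
    by rewrite w0w (innerBr hw0 (V2 _ Vb) hw) (wV b Vb) subr0.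
  rewrite (le_trans (Cauchy_Schwarz hw hwb))// ler_wpM2l ?inner_ge0//.
  exact: ltW.
have w00 : inner eta w0 w0 = 0.
  have N0 := inner_ge0 eta w0; have S0 := inner_ge0 eta w.
  apply/eqP; rewrite eq_le N0 andbT leNgt; apply/negP => Ngt0.
  (* For this e the bound [w0e] would be strictly smaller than its left-hand side; the added 1 keeps
     the denominator positive. *)
  have e0 : 0 < inner eta w0 w0 ^+ 2 / (inner eta w w + 1).
    by rewrite divr_gt0 ?exprn_gt0// ltr_wpDl.
  have := w0e _ e0; rewrite leNgt => /negP; apply.
  rewrite mulrCA -[ltRHS]mulr1 ltr_pM2l ?exprn_gt0// ltr_pdivrMr; lra.
exists (phi + m), g1; split; first exact: hg1.1.
apply: filterS2 (inner_eq0 hw0 w00) (ae_integrable1 (rintegrable_sqr_snd_joint hg1)).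
by move=> x w0x ig2; split => //; move: w0x; rewrite /w0 /w; lra.
Qed.

End InformationOperator.

(** * Inverse Gaussian densities *)

Section InverseGaussian.
Context {R : realType}.
Implicit Types (a t : R).

Lemma measurable_invr : measurable_fun setT (fun x : R => x^-1).
Proof.
(* Passing through x^2 reduces negative x to the nonnegative case, where the inverse is a power. *)
rewrite (_ : (fun _ => _) = (fun x => x * (x ^+ 2) `^ (-1))).
  apply: measurable_funM => //.
  exact: (measurableT_comp (measurable_powR _)).
apply/funext => x; rewrite powR_inv1 ?sqr_ge0//.
have [->|x0] := eqVneq x 0; first by rewrite invr0 mul0r.
by rewrite expr2 invfM mulrA divff// mul1r.
Qed.

Lemma powRN32 t : 0 < t -> t `^ (- (3 / 2)) = (Num.sqrt t ^+ 3)^-1.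
Proof.
move=> t0; rewrite powRN -powR12_sqrt ?ltW// -powR_mulrn ?powR_ge0//.
by rewrite -powRrM; congr ((_ `^ _)^-1); field.
Qed.

(* Up to a constant, the inverse Gaussian density of the first passage at level
   [a2] of a Brownian motion with drift [a1]. *)
Definition passage_density a1 a2 t : R :=
  `|a2| * t `^ (- (3 / 2)) * expR (- ((a1 * t - a2) ^+ 2 / (2 * t))).

Lemma passage_density_ge0 a1 a2 t : 0 <= passage_density a1 a2 t.
Proof. by rewrite /passage_density !mulr_ge0// ?powR_ge0// expR_ge0. Qed.

Lemma measurable_passage_density a1 a2 :
  measurable_fun setT (passage_density a1 a2).
Proof.
apply: measurable_funM.
  by apply: measurable_funM => //; exact: measurable_powR.
apply: (measurableT_comp (@measurable_expR R)); apply: measurableT_comp => //.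
apply: measurable_funM.
  by apply: measurable_funX; apply: measurable_funB => //; exact: measurable_funM.
by apply: (measurableT_comp measurable_invr); exact: measurable_funM.
Qed.

(** The exponent of [passage_density] is - y^2 / 2. The majorant [G'] is the derivative of 4 atan y,
    whose total variation over an interval where it increases is at most 4 pi, independently of a1
    and a2. *)
Let y a1 a2 t : R := a1 * Num.sqrt t - a2 * (Num.sqrt t)^-1.

Let dy a1 a2 t : R := a1 * (2 * Num.sqrt t)^-1 + a2 * (2 * Num.sqrt t ^+ 3)^-1.

Let is_derive_y a1 a2 t : 0 < t -> is_derive t 1 (y a1 a2) (dy a1 a2 t).
Proof.
move=> t0; have s0 : 0 < Num.sqrt t by rewrite sqrtr_gt0.
have ds := is_derive1_sqrt t0.
have dV : is_derive t 1 (fun u => (Num.sqrt u)^-1)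
    (- (Num.sqrt t) ^- 2 * (2 * Num.sqrt t)^-1).
  apply: is_derive_eq; first by apply: is_deriveV; rewrite gt_eqF.
  by rewrite /GRing.scale/=.
have dB := is_deriveB (is_deriveZ a1 ds) (is_deriveZ a2 dV).
apply: (is_derive_eq dB); rewrite /dy /GRing.scale/=; field; rewrite gt_eqF//.
Qed.

Let G' a1 a2 t : R := 4 * dy a1 a2 t / (1 + y a1 a2 t ^+ 2).

Let is_derive_G a1 a2 t : 0 < t ->
  is_derive t 1 (fun u => 4 * atan (y a1 a2 u)) (G' a1 a2 t).
Proof.
move=> t0; have dt := is_derive_y a1 a2 t0.
have dG := is_derive1_comp (is_derive1_atan (y a1 a2 t)) dt.
have dZ := is_deriveZ 4 dG; apply: (is_derive_eq dZ).
by rewrite /G' /GRing.scale/= -mulrA; congr (_ * _); rewrite mulrC.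
Qed.

Let continuous_G' a1 a2 t : 0 < t -> {for t, continuous (G' a1 a2)}.
Proof.
move=> t0; have s0 : 0 < Num.sqrt t by rewrite sqrtr_gt0.
have cs : {for t, continuous (@Num.sqrt R)} by exact: sqrt_continuous.
have cy : {for t, continuous (y a1 a2)}.
  apply: cvgB; first by apply: cvgM => //; exact: cvg_cst.
  apply: cvgM; first exact: cvg_cst.
  by apply: cvgV => //; rewrite gt_eqF.
apply: cvgM.
  apply: cvgM; first exact: cvg_cst.
  apply: cvgD; (apply: cvgM; first exact: cvg_cst); apply: cvgV.
  - by rewrite gt_eqF// mulr_gt0.
  - by apply: cvgM => //; exact: cvg_cst.
  - by rewrite gt_eqF// mulr_gt0// exprn_gt0.
  - apply: cvgM; first exact: cvg_cst.
    exact: (continuous_comp cs (@exprn_continuous R 3 _)).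
apply: cvgV; first by rewrite gt_eqF// ltr_wpDr// sqr_ge0.
apply: cvgD; first exact: cvg_cst.
exact: (continuous_comp cy (@exprn_continuous R 2 _)).
Qed.

(* [exp(- y^2 / 2) <= 2 / (1 + y^2)], and [y' >= a2 / (2 t^(3/2))]. *)
Let passage_density_le_G' a1 a2 t : 0 <= a1 -> 0 < a2 -> 0 < t ->
  passage_density a1 a2 t <= G' a1 a2 t.
Proof.
move=> a10 a20 t0; have s0 : 0 < Num.sqrt t by rewrite sqrtr_gt0.
rewrite /passage_density powRN32// gtr0_norm// /G' /dy /y.
have ts : t = Num.sqrt t ^+ 2 by rewrite sqr_sqrtr// ltW.
set s := Num.sqrt t in s0 ts *; rewrite ts.
set u := a1 * s - a2 * s^-1.
have -> : (a1 * s ^+ 2 - a2) ^+ 2 / (2 * s ^+ 2) = u ^+ 2 / 2.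
  by rewrite /u; field; rewrite gt_eqF.
have u2 := sqr_ge0 u.
have e1 : expR (- (u ^+ 2 / 2)) <= 2 / (1 + u ^+ 2).
  rewrite expRN -[leRHS]invrK invf_div lef_pV2 ?posrE ?expR_gt0//.
    by rewrite (le_trans _ (expR_ge1Dx _))//; lra.
  by rewrite divr_gt0//; lra.
have c0 : 0 <= a2 * (s ^+ 3)^-1 by rewrite mulr_ge0 ?invr_ge0 ?exprn_ge0 ?ltW.
rewrite (le_trans (ler_wpM2l c0 e1))// mulrA ler_wpM2r ?invr_ge0 ?addr_ge0//.
have -> : 4 * (a1 * (2 * s)^-1 + a2 * (2 * s ^+ 3)^-1) =
  a2 * (s ^+ 3)^-1 * 2 + 2 * (a1 / s) by field; rewrite gt_eqF.
by rewrite lerDl mulr_ge0// divr_ge0// ltW.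
Qed.

Let integral_itv_le a1 a2 c d : 0 <= a1 -> 0 < a2 -> 0 < c -> c < d ->
  (\int[lebesgue_measure]_(t in `[c, d]) (passage_density a1 a2 t)%:E
   <= (4 * pi)%:E)%E.
Proof.
move=> a10 a20 c0 cd.
have cG : {within `[c, d], continuous (G' a1 a2)}.
  apply: continuous_in_subspaceT => t; rewrite inE/= in_itv/= => /andP[ct _].
  by apply: continuous_G'; exact: lt_le_trans ct.
have cF t : c <= t -> {for t, continuous (fun u => 4 * atan (y a1 a2 u))}.
  move=> ct; apply/differentiable_continuous/derivable1_diffP.
  by have [] := is_derive_G a1 a2 (lt_le_trans c0 ct).
apply: (@le_trans _ _ (\int[lebesgue_measure]_(t in `[c, d]) (G' a1 a2 t)%:E)%E).
  apply: ge0_le_integral => //.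
  - by move=> t _; rewrite lee_fin passage_density_ge0.
  - by apply/measurable_EFinP/measurable_funTS; exact: measurable_passage_density.
  - apply/measurable_EFinP; apply: subspace_continuous_measurable_fun => //.
  - move=> t; rewrite /= in_itv/= => /andP[ct _]; rewrite lee_fin.
    by apply: passage_density_le_G' => //; exact: lt_le_trans ct.
rewrite (continuous_FTC2 cd cG (F := fun u => 4 * atan (y a1 a2 u))).
- rewrite -EFinB lee_fin.
  have := atan_gtNpi2 (y a1 a2 c); have := atan_ltpi2 (y a1 a2 d); lra.
- split.
  + move=> t; rewrite in_itv/= => /andP[ct _].
    by have [] := is_derive_G a1 a2 (lt_trans c0 ct).
  + by apply: cvg_at_right_filter; apply: cF.
  + by apply: cvg_at_left_filter; apply: cF; exact: ltW.
- move=> t; rewrite in_itv/= => /andP[ct _].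
  have dG := is_derive_G a1 a2 (lt_trans c0 ct).
  by rewrite derive1E derive_val.
Qed.

Let integral_itv_oo_le a1 a2 : 0 <= a1 -> 0 < a2 ->
  (\int[lebesgue_measure]_(t in `]0%R, +oo[) (passage_density a1 a2 t)%:E
   <= (4 * pi)%:E)%E.
Proof.
(* Starting at n + 2 makes the interval nondegenerate already for n = 0, as [integral_itv_le]
   requires. *)
move=> a10 a20; pose F n := `[(n.+2%:R : R)^-1, n.+2%:R]%classic.
have -> : `]0%R, +oo[%classic = \bigcup_n F n.
  apply/seteqP; split=> t /=.
    rewrite in_itv/= andbT => t0.
    exists (Num.bound t + Num.bound t^-1)%N => //; rewrite /F/= in_itv/=.
    have b1 := archi_boundP (ltW t0).
    have ti0 : 0 <= t^-1 by rewrite invr_ge0 ltW.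
    have b2 := archi_boundP ti0.
    set i := Num.Def.archi_bound t in b1 *; set j := Num.Def.archi_bound _ in b2 *.
    apply/andP; split.
      rewrite -[leRHS]invrK lef_pV2 ?posrE ?invr_gt0 ?ltr0n//.
      apply: (le_trans (ltW b2)); rewrite ler_nat.
      by rewrite (leq_trans (leq_addl i _))// (leq_trans (leqnSn _))// leqnSn.
    apply: (le_trans (ltW b1)); rewrite ler_nat.
    by rewrite (leq_trans (leq_addr j _))// (leq_trans (leqnSn _))// leqnSn.
  by move=> [n _]; rewrite /F /= !in_itv/= andbT => /andP[nt _]; rewrite (lt_le_trans _ nt)// invr_gt0.
have ndF : nondecreasing_seq F.
  move=> m n mn; apply/subsetPset => t; rewrite /F /= !in_itv/= => /andP[mt tm].
  apply/andP; split.
    by rewrite (le_trans _ mt)// lef_pV2 ?posrE// ler_nat !ltnS.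
  by rewrite (le_trans tm)// ler_nat !ltnS.
have cv : (\int[lebesgue_measure]_(t in F n) (passage_density a1 a2 t)%:E @[n --> \oo]
    --> \int[lebesgue_measure]_(t in \bigcup_n F n) (passage_density a1 a2 t)%:E)%E.
  apply: ge0_nondecreasing_set_cvg_integral => //.
  - by move=> n; exact: measurable_itv.
  - move=> n; apply/measurable_funTS/measurable_EFinP.
    exact: measurable_passage_density.
  - by move=> n t _; rewrite lee_fin passage_density_ge0.
rewrite -(cvg_lim _ cv)//; apply: lime_le; first by apply/cvg_ex; eexists; exact: cv.
apply: nearW => n; apply: integral_itv_le => //.
by rewrite (@lt_trans _ _ 1) ?invf_lt1 ?ltr1n.
Qed.

(** The sign of a2 is removed by changing the signs of both parameters, and a negative drift is
    compared with drift 0. *)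
Lemma integral_passage_density_le a1 a2 :
  (\int[lebesgue_measure]_(t in `]0%R, +oo[) (passage_density a1 a2 t)%:E
   <= (4 * pi)%:E)%E.
Proof.
have pos b1 b2 : 0 < b2 ->
  (\int[lebesgue_measure]_(t in `]0%R, +oo[) (passage_density b1 b2 t)%:E
   <= (4 * pi)%:E)%E.
  move=> b20; have [b10|b10] := leP 0 b1; first exact: integral_itv_oo_le.
  apply: le_trans (integral_itv_oo_le (lexx 0) b20).
  apply: ge0_le_integral => //.
  - by move=> t _; rewrite lee_fin passage_density_ge0.
  - by apply/measurable_EFinP/measurable_funTS; exact: measurable_passage_density.
  - by apply/measurable_EFinP/measurable_funTS; exact: measurable_passage_density.
  move=> t; rewrite /= in_itv/= andbT => t0; rewrite lee_fin /passage_density.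
  rewrite ler_wpM2l ?mulr_ge0 ?powR_ge0// ler_expR lerN2.
  (* (b1 t - b2)^2 - b2^2 is the product of the nonpositive numbers b1 t and b1 t - 2 b2, so drift 0
     has the larger exponential. *)
  have bt : b1 * t <= 0 by rewrite mulr_le0_ge0// ltW.
  have bt2 : b1 * t - 2 * b2 <= 0 by lra.
  have h := mulr_le0 bt bt2.
  rewrite ler_pM2r ?invr_gt0 ?mulr_gt0// mul0r sub0r sqrrN !expr2; nra.
have [a20|a20|a20] := ltgtP a2 0; last 1 first.
- rewrite (eq_integral (cst 0%E)) ?integral0.
    by rewrite lee_fin mulr_ge0// pi_ge0.
  by move=> t _; rewrite /passage_density a20 normr0 !mul0r.
- have -> : passage_density a1 a2 = passage_density (- a1) (- a2).
    apply/funext => t; rewrite /passage_density normrN.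
    by rewrite (_ : (- a1 * t - - a2) ^+ 2 = (a1 * t - a2) ^+ 2)//; ring.
  by apply: pos; rewrite oppr_gt0.
- exact: pos.
Qed.

End InverseGaussian.

(** * Laplace transforms *)

Section LaplaceTransform.
Context {d} {Z : measurableType d} {R : realType}.
Variable lam : {measure set Z -> \bar R}.
Variables w s p g : Z -> R.
Hypotheses (mw : measurable_fun setT w) (ms : measurable_fun setT s)
  (mp : measurable_fun setT p) (mg : measurable_fun setT g).
Hypotheses (w0 : forall z, 0 <= w z) (s0 : forall z, 0 <= s z)
  (p0 : forall z, 0 <= p z).
Implicit Types u v : R.

Definition laplace_kernel u v z := w z * expR (- (u * s z) - v * p z).

Definition laplace u v := \int[lam]_z (g z * laplace_kernel u v z).

Local Notation k := laplace_kernel.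

Definition square_domain u v := rintegrable lam (fun z => g z ^+ 2 * k u v z).

Hypothesis int_kernel : forall u v, 0 < u -> 0 < v -> rintegrable lam (k u v).

Lemma laplace_kernel_ge0 u v z : 0 <= k u v z.
Proof. by rewrite mulr_ge0// expR_ge0. Qed.

Lemma measurable_laplace_kernel u v : measurable_fun setT (k u v).
Proof.
apply: measurable_funM => //; apply: (measurableT_comp (@measurable_expR R)).
apply: measurable_funB; last exact: measurable_funM.
by apply: measurableT_comp => //; exact: measurable_funM.
Qed.

Lemma laplace_kernel_le u v u' v' z : u <= u' -> v <= v' -> k u' v' z <= k u v z.
Proof.
move=> uu' vv'; rewrite ler_wpM2l// ler_expR lerB// ?lerN2 ler_wpM2r//.
Qed.

Lemma square_domain_le u v u' v' : u <= u' -> v <= v' ->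
  square_domain u v -> square_domain u' v'.
Proof.
move=> uu' vv' Duv; apply: le_rintegrable Duv.
  by apply: measurable_funM; [exact: measurable_funX|exact: measurable_laplace_kernel].
move=> z; have k0 : 0 <= g z ^+ 2 * k u' v' z.
  by apply: mulr_ge0; [exact: sqr_ge0|exact: laplace_kernel_ge0].
rewrite (ger0_norm k0).
by rewrite ler_wpM2l ?sqr_ge0// laplace_kernel_le.
Qed.

(** The exponential at (u', v') is the geometric mean of those at (u, v) and (2 u' - u, 2 v' - v).
    The first is integrable against g^2, and the second point lies in the open quadrant, where the
    kernel itself is integrable. *)
Lemma rintegrable_laplace u v u' v' : square_domain u v ->
  u < 2 * u' -> v < 2 * v' -> rintegrable lam (fun z => g z * k u' v' z).
Proof.
move=> Duv uu' vv'.
have ik : rintegrable lam (k (2 * u' - u) (2 * v' - v)).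
  by apply: int_kernel; rewrite subr_gt0.
apply: le_rintegrable (rintegrableD Duv ik).
  by apply: measurable_funM => //; exact: measurable_laplace_kernel.
move=> z; rewrite /laplace_kernel mulrCA [g z ^+ 2 * _]mulrCA -mulrDr.
rewrite normrM (ger0_norm (w0 z)) ler_wpM2l//.
set a := expR (- (u' * s z) - _); set b := expR (- (u * s z) - _); set c := expR _.
have abc : a ^+ 2 = b * c.
  by rewrite -expRD -expRM_natl; congr expR; rewrite mulr2n; ring.
have b0 : 0 < b by exact: expR_gt0.
have c0 : 0 < c by exact: expR_gt0.
have g2b : 0 <= g z ^+ 2 * b + c by apply: addr_ge0; [apply: mulr_ge0; [exact: sqr_ge0|exact: ltW]|exact: ltW].
rewrite -ler_sqr ?nnegrE// real_normK ?num_real// exprMn abc.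
have := sqr_ge0 (g z ^+ 2 * b - c); have : 0 <= g z ^+ 2 * (b * c).
  by rewrite mulr_ge0 ?sqr_ge0// ltW// mulr_gt0.
rewrite !expr2; nra.
Qed.

Lemma expR_diff_le (x y m : R) : m <= x -> m <= y ->
  `|expR (- x) - expR (- y)| <= `|x - y| * expR (- m).
Proof.
wlog xy : x y / x <= y.
  move=> H mx my; have [xy|/ltW yx] := leP x y; first exact: H.
  by rewrite distrC (distrC x); exact: H.
move=> mx my; rewrite ger0_norm ?subr_ge0 ?ler_expR ?lerN2//.
rewrite distrC ger0_norm ?subr_ge0//.
have -> : - y = - x + (x - y) by ring.
rewrite expRD -{1}[expR (- x)]mulr1 -mulrBr mulrC.
have e1 := expR_ge1Dx (x - y).
have yx : 0 <= y - x by lra.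
apply: (@le_trans _ _ ((y - x) * expR (- x))).
  by rewrite ler_wpM2r ?expR_ge0//; lra.
by rewrite ler_wpM2l// ler_expR lerN2.
Qed.

(** The transform is Lipschitz near (u', v'). Moving the point back by 2 e keeps integrability: one
    e leaves room for the neighborhood, the other absorbs the factor s + p of the difference
    quotient through e (s + p) <= exp (e (s + p)). *)
Lemma laplace_continuous u v u' v' : square_domain u v ->
  u < 2 * u' -> v < 2 * v' ->
  {for (u', v'), continuous (fun q : R * R => laplace q.1 q.2)}.
Proof.
move=> Duv uu' vv'.
pose e : R := Num.min (u' - u / 2) (v' - v / 2) / 3.
have e0 : 0 < e by rewrite divr_gt0// lt_min; apply/andP; split; lra.
have eu : u < 2 * (u' - 2 * e).
  have : Num.min (u' - u / 2) (v' - v / 2) <= u' - u / 2 by rewrite ge_min lexx.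
  rewrite /e in e0 *; lra.
have ev : v < 2 * (v' - 2 * e).
  have : Num.min (u' - u / 2) (v' - v / 2) <= v' - v / 2 by rewrite ge_min lexx orbT.
  rewrite /e in e0 *; lra.
have ib := rintegrable_laplace Duv eu ev.
have ia : rintegrable lam (fun z => `|g z * k (u' - 2 * e) (v' - 2 * e) z|).
  exact: integrable_norm.
set b := \int[lam]_z `|g z * k (u' - 2 * e) (v' - 2 * e) z|.
have b0 : 0 <= b by apply: Rintegral_ge0.
have lip q : `|q.1 - u'| < e -> `|q.2 - v'| < e ->
    `|laplace q.1 q.2 - laplace u' v'| <= (`|q.1 - u'| + `|q.2 - v'|) / e * b.
  move=> q1 q2; set D := `|q.1 - u'| + `|q.2 - v'|.
  have := q1; rewrite ltr_norml => /andP[q1l q1r].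
  have := q2; rewrite ltr_norml => /andP[q2l q2r].
  have iq : rintegrable lam (fun z => g z * k q.1 q.2 z).
    by apply: rintegrable_laplace Duv _ _; lra.
  have iu : rintegrable lam (fun z => g z * k u' v' z).
    exact: rintegrable_laplace Duv _ _.
  have iB := rintegrableB iq iu.
  rewrite -RintegralB// (le_trans (le_normr_Rintegral measurableT iB))//.
  rewrite /b -RintegralZl//; apply: le_Rintegral => //.
  - exact: integrable_norm.
  - exact: rintegrableZ.
  move=> z _; rewrite /laplace_kernel -!mulrBr !normrM (ger0_norm (w0 z)).
  rewrite (ger0_norm (expR_ge0 _)) [leRHS]mulrCA ler_wpM2l//.
  rewrite [leRHS]mulrCA ler_wpM2l//.
  have sz := s0 z; have pz := p0 z.
  have -> : - (q.1 * s z) - q.2 * p z = - (q.1 * s z + q.2 * p z) by ring.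
  have -> : - (u' * s z) - v' * p z = - (u' * s z + v' * p z) by ring.
  have m1 : (u' - e) * s z + (v' - e) * p z <= q.1 * s z + q.2 * p z.
    by rewrite lerD// ler_wpM2r//; lra.
  have m2 : (u' - e) * s z + (v' - e) * p z <= u' * s z + v' * p z.
    by rewrite lerD// ler_wpM2r//; lra.
  rewrite (le_trans (expR_diff_le m1 m2))//.
  have -> : - ((u' - 2 * e) * s z) - (v' - 2 * e) * p z =
    - ((u' - e) * s z + (v' - e) * p z) + e * (s z + p z) by ring.
  rewrite expRD [leRHS]mulrCA [leLHS]mulrC ler_wpM2l ?expR_ge0//.
  have D0 : 0 <= D by rewrite addr_ge0.
  apply: (@le_trans _ _ (D * (s z + p z))).
    have -> : q.1 * s z + q.2 * p z - (u' * s z + v' * p z) =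
      (q.1 - u') * s z + (q.2 - v') * p z by ring.
    rewrite (le_trans (ler_normD _ _))// !normrM (ger0_norm sz) (ger0_norm pz).
    have := normr_ge0 (q.1 - u'); have := normr_ge0 (q.2 - v'); rewrite /D; nra.
  rewrite -mulrA ler_wpM2l// mulrC ler_pdivlMr// mulrC.
  by rewrite (le_trans _ (expR_ge1Dx _))//; lra.
apply/cvgrPdist_lt => /= r r0.
(* Each of the two coordinates contributes at most half of r; b + 1 replaces b, which may be 0. *)
pose del := Num.min e (r * e / (2 * (b + 1))).
have del0 : 0 < del.
  by rewrite lt_min e0/=; apply: divr_gt0; apply: mulr_gt0 => //; lra.
exists (ball u' del, ball v' del); first by split; exact: nbhsx_ballx.
move=> [q1 q2] /= [B1 B2]; rewrite distrC.
have h1 : `|q1 - u'| < del by rewrite distrC.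
have h2 : `|q2 - v'| < del by rewrite distrC.
have dele : del <= e by rewrite ge_min lexx.
have delr : del <= r * e / (2 * (b + 1)) by rewrite ge_min lexx orbT.
rewrite (le_lt_trans (lip (q1, q2) (lt_le_trans h1 dele) (lt_le_trans h2 dele)))//=.
have b1 : 0 < b + 1 by rewrite ltr_wpDl.
have hs : `|q1 - u'| + `|q2 - v'| < r * e / (b + 1).
  have -> : r * e / (b + 1) = r * e / (2 * (b + 1)) + r * e / (2 * (b + 1)).
    by field; rewrite gt_eqF.
  by rewrite ltrD// (lt_le_trans _ delr).
have := hs; rewrite ltr_pdivlMr// => hs2.
rewrite mulrAC ltr_pdivrMr//.
have := normr_ge0 (q1 - u'); have := normr_ge0 (q2 - v'); nra.
Qed.

Section BoundedExponent.
Variable B : R.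
Hypothesis sB : forall z, s z <= B.

(** For s between 0 and B, changing u into u' multiplies the kernel by at most exp (|u - u'| B). *)
Lemma rintegrable_shift (f : Z -> R) u u' v : measurable_fun setT f ->
  rintegrable lam (fun z => f z * k u v z) ->
  rintegrable lam (fun z => f z * k u' v z).
Proof.
move=> mf ifk.
have hn : rintegrable lam (fun z => `|f z * k u v z|) by exact: integrable_norm.
apply: le_rintegrable (rintegrableZ (expR (`|u - u'| * B)) hn).
  by apply: measurable_funM => //; exact: measurable_laplace_kernel.
move=> z; rewrite /laplace_kernel !normrM (ger0_norm (w0 z)).
rewrite !(ger0_norm (expR_ge0 _)) [leRHS]mulrCA ler_wpM2l//.
rewrite [leRHS]mulrCA ler_wpM2l// -expRD ler_expR.
have : (u - u') * s z <= `|u - u'| * B.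
  by rewrite (le_trans (ler_norm _))// normrM (ger0_norm (s0 z)) ler_wpM2l.
lra.
Qed.

Lemma exponential_integral_derive (G : Z -> R) u : rintegrable lam G ->
  is_derive u 1 (fun x : R => \int[lam]_z (G z * expR (- (x * s z))))
    (\int[lam]_z (- s z * G z * expR (- (u * s z)))).
Proof.
move=> iG; have mG := rintegrable_measurable iG.
pose f x z : R := G z * expR (- (x * s z)).
have mexp x : measurable_fun setT (fun z => expR (- (x * s z))).
  apply: (measurableT_comp (@measurable_expR R)); apply: measurableT_comp => //.
  exact: measurable_funM.
have B0 : 0 <= B by apply: le_trans (sB point).
have exp_le x z : `|x - u| < 1 -> expR (- (x * s z)) <= expR ((`|u| + 1) * B).
  move=> xu; rewrite ler_expR -mulNr.
  have xu1 : - x <= `|u| + 1.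
    rewrite (le_trans (ler_norm _))// normrN -(subrK u x).
    by rewrite (le_trans (ler_normD _ _))// addrC lerD// ltW.
  have u1 : 0 <= `|u| + 1 by rewrite addr_ge0.
  by rewrite (le_trans (ler_wpM2r (s0 z) xu1))// ler_wpM2l.
have near_u x : `]u - 1, u + 1[%classic x -> `|x - u| < 1.
  rewrite /= in_itv/= => /andP[h1 h2]; rewrite ltr_norml; apply/andP; split; lra.
have intf x : `]u - 1, u + 1[%classic x -> lam.-integrable setT (EFin \o f x).
  move=> /near_u xu; have hn : rintegrable lam (fun z => `|G z|) by exact: integrable_norm.
  apply: (le_rintegrable _ _ (rintegrableZ (expR ((`|u| + 1) * B)) hn)).
    by apply: measurable_funM.
  move=> z; rewrite normrM mulrC ger0_norm ?expR_ge0// ler_wpM2r//.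
  exact: exp_le.
have df x z : is_derive x (1 : R) (f ^~ z) (- s z * G z * expR (- (x * s z))).
  have dlin : is_derive x (1 : R) (fun x => - (x * s z)) (- s z).
    have -> : (fun x => - (x * s z)) = (fun x => - s z * x).
      by apply/funext => t; rewrite mulNr mulrC.
    have did := is_deriveZ (- s z) (is_derive_id x (1 : R)).
    by apply: (is_derive_eq did); rewrite /GRing.scale/= mulr1.
  have de := @is_derive1_comp _ expR (fun x => - (x * s z)) x _ _ (is_derive_expR _) dlin.
  have dZ := is_deriveZ (G z) de.
  by apply: (is_derive_eq dZ); rewrite /GRing.scale/=; ring.
(* Dominates the derivative in x over the whole interval |x - u| < 1, which may contain negative
   x. *)
pose GG z := B * expR ((`|u| + 1) * B) * `|G z|.
have iGG : lam.-integrable setT (EFin \o GG).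
  by apply: rintegrableZ; exact: integrable_norm.
have GG0 z : 0 <= GG z by rewrite !mulr_ge0// expR_ge0.
have dE x z : partial1of2 f x z = - s z * G z * expR (- (x * s z)).
  by rewrite partial1of2E; have d1 := df x z; rewrite derive_val.
have ubG x z : `]u - 1, u + 1[%classic x -> setT z -> `|partial1of2 f x z| <= GG z.
  move=> /near_u xu _; rewrite dE /GG !normrM normrN (ger0_norm (s0 z)).
  rewrite mulrAC ler_wpM2r// ger0_norm ?expR_ge0//.
  by rewrite ler_pM ?expR_ge0// exp_le.
have uI : `]u - 1, u + 1[%classic u by rewrite /= in_itv/=; apply/andP; split; lra.
have df' x z : `]u - 1, u + 1[%classic x -> setT z -> derivable (f ^~ z) x 1.
  by move=> _ _; have [] := df x z.
apply: DeriveDef.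
  exact: (derivable_under_integral measurableT uI intf df' GG0 iGG ubG).
rewrite -derive1E (differentiation_under_integral measurableT uI intf df' GG0 iGG ubG).
by apply: eq_Rintegral => z _; rewrite dE.
Qed.

(** Each derivative is an integral of the same form, with G multiplied by - s, hence still
    integrable as s is bounded. *)
Lemma exponential_integral_smooth (G : Z -> R) n u : rintegrable lam G ->
  derivable (fun x : R => \int[lam]_z (G z * expR (- (x * s z))))^`(n)%classic u 1.
Proof.
move=> iG; pose Gn j z := (- s z) ^+ j * G z.
have iGn j : rintegrable lam (Gn j).
  have hn : rintegrable lam (fun z => `|G z|) by exact: integrable_norm.
  apply: (le_rintegrable _ _ (rintegrableZ (B ^+ j) hn)).
    apply: measurable_funM; last exact: rintegrable_measurable iG.
    by apply: measurable_funX; exact: measurableT_comp.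
  move=> z; rewrite normrM ler_wpM2r// normrX normrN (ger0_norm (s0 z)).
  by rewrite lerXn2r ?nnegrE// (le_trans (s0 z)).
have -> : (fun x : R => \int[lam]_z (G z * expR (- (x * s z))))^`(n)%classic =
    (fun x : R => \int[lam]_z (Gn n z * expR (- (x * s z)))).
  elim: n => [|n IH].
    by apply/funext => x; apply: eq_Rintegral => z _; rewrite /Gn expr0 mul1r.
  rewrite derive1nS IH; apply/funext => x; rewrite derive1E.
  have dn := exponential_integral_derive x (iGn n); rewrite derive_val.
  by apply: eq_Rintegral => z _; rewrite /Gn exprS mulrA.
by have [] := exponential_integral_derive u (iGn n).
Qed.

Lemma laplace_smooth u0 v n u : rintegrable lam (fun z => g z * k u0 v z) ->
  derivable (laplace ^~ v)^`(n)%classic u 1.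
Proof.
(* At u = 0 the weight and the factor in v can be absorbed into G. *)
move=> /(rintegrable_shift 0 mg) ig0.
have -> : laplace ^~ v =
    (fun x : R => \int[lam]_z ((g z * k 0 v z) * expR (- (x * s z)))).
  apply/funext => x; apply: eq_Rintegral => z _.
  rewrite /laplace_kernel -!mulrA -expRD; congr (_ * (_ * expR _)); ring.
exact: exponential_integral_smooth.
Qed.

End BoundedExponent.

(* [h] is [laplace] composed with the retraction moving each point along [(e, 1)]
   until it reaches the closure of [square_domain].  When [s] is bounded,
   [square_domain] does not depend on [u]; then [e = 0], so that the retraction
   does not spoil the smoothness in [u]. *)
Lemma laplace_extension : exists h : R * R -> R,
  [/\ {within [set q : R * R | 0 < q.1 /\ 0 < q.2], continuous h},
      forall u v, 0 < u -> 0 < v -> square_domain u v -> h (u, v) = laplace u v &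
      (exists B, forall z, s z <= B) -> forall u v, 0 < u -> 0 < v ->
        forall n, derivable (fun x => h (x, v))^`(n)%classic u 1].
Proof.
have [[u0 [v0 D0]]|D0] := pselect (exists u v, square_domain u v); last first.
  exists (cst 0); split.
  - by apply: continuous_subspaceT => q; exact: cst_continuous.
  - by move=> u v _ _ Duv; exfalso; apply: D0; exists u, v.
  - move=> _ u v _ _ n.
    rewrite [X in derivable X](_ : _ = cst 0); first exact: derivable_cst.
    elim: n => [//|n IH]; rewrite derive1nS IH; apply/funext => x.
    exact: derive1_cst.
pose bdd := exists B, forall z, s z <= B.
pose e : R := if pselect bdd then 0 else 1.
have e01 : e = 0 \/ e = 1 by rewrite /e; case: pselect; [left|right].
have inv : e = 0 -> forall u u' v, square_domain u v -> square_domain u' v.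
  rewrite /e; case: pselect => [[B sB] _|_ /eqP]; last by rewrite oner_eq0.
  move=> u u' v; apply: (rintegrable_shift sB).
  exact: measurable_funX.
(* The times at which the ray from q along (e, 1) is in the domain; [del q] is the entry time. *)
pose S (q : R * R) := [set t | 0 <= t /\ square_domain (q.1 + e * t) (q.2 + t)].
pose del q := inf (S q).
(* The domain is closed under increasing coordinates, so waiting r longer compensates for a
   displacement of at most r; hence [del] is 1-Lipschitz. *)
have S_move q q' r t : `|q.1 - q'.1| <= r -> `|q.2 - q'.2| <= r -> S q t ->
    S q' (t + r).
  move=> h1 h2 [t0 Dt]; have r0 : 0 <= r by apply: le_trans h1.
  split; first exact: addr_ge0.
  have h2' : q.2 + t <= q'.2 + (t + r).
    by have := ler_norm (q.2 - q'.2); lra.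
  have [e0|e1] := e01.
    apply: (inv e0 (q.1 + e * t)); exact: square_domain_le Dt.
  apply: square_domain_le Dt => //.
  by have := ler_norm (q.1 - q'.1); rewrite e1; lra.
have S0 q : S q !=set0.
  have [e0|e1] := e01.
    exists `|v0 - q.2|; split => //; apply: (inv e0 u0).
    by apply: square_domain_le D0 => //; have := ler_norm (v0 - q.2); lra.
  exists (`|u0 - q.1| + `|v0 - q.2|); split; first exact: addr_ge0.
  have n1 := normr_ge0 (u0 - q.1); have n2 := normr_ge0 (v0 - q.2).
  have l1 := ler_norm (u0 - q.1); have l2 := ler_norm (v0 - q.2).
  by apply: square_domain_le D0; rewrite ?e1; lra.
have Slb q : lbound (S q) 0 by move=> t [].
have Sinf q : has_inf (S q) by split; [exact: S0|exists 0].
have del_ge0 q : 0 <= del q by apply: lb_le_inf.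
have del_lip q q' r : `|q.1 - q'.1| <= r -> `|q.2 - q'.2| <= r ->
    del q' <= del q + r.
  move=> h1 h2; rewrite -lerBlDr; apply: lb_le_inf => // t St.
  rewrite lerBlDr; apply: ge_inf; first by exists 0.
  exact: S_move h1 h2 St.
have del_cont : continuous del.
  move=> q; apply/cvgrPdist_le => /= r r0.
  exists (ball q.1 r, ball q.2 r); first by split; exact: nbhsx_ballx.
  move=> [q1 q2] /= [/ltW B1 /ltW B2].
  have d1 := del_lip q (q1, q2) r B1 B2.
  have d2 : del q <= del (q1, q2) + r by apply: del_lip; rewrite distrC.
  by rewrite ler_norml; apply/andP; split; lra.
pose h (q : R * R) := laplace (q.1 + e * del q) (q.2 + del q).
(* The retracted point may lie outside the domain, on its boundary. The ray enters the domain less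
   than min q.1 q.2 after time [del q], and such a domain point is below twice the retracted point,
   as [rintegrable_laplace] demands. *)
have reach (q : R * R) : 0 < q.1 -> 0 < q.2 -> exists u v,
    [/\ square_domain u v, u < 2 * (q.1 + e * del q) & v < 2 * (q.2 + del q)].
  move=> q10 q20; have m0 : 0 < Num.min q.1 q.2 by rewrite lt_min q10.
  have [t [t0 Dt]] := inf_adherent m0 (Sinf q); rewrite -/(del q) => tlt.
  have m1 : Num.min q.1 q.2 <= q.1 by rewrite ge_min lexx.
  have m2 : Num.min q.1 q.2 <= q.2 by rewrite ge_min lexx orbT.
  have d0 := del_ge0 q.
  exists (q.1 + e * t), (q.2 + t); split => //; last by lra.
  by have [->|->] := e01; lra.
exists h; split.
- apply: continuous_in_subspaceT => q; rewrite inE => -[q10 q20].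
  have [u [v [Duv hu hv]]] := reach _ q10 q20.
  have cl := laplace_continuous Duv hu hv.
  have c1 : {for q, continuous (fun q : R * R => q.1 + e * del q)}.
    apply: cvgD; first exact: cvg_fst.
    by apply: cvgM; [exact: cvg_cst|exact: del_cont].
  have c2 : {for q, continuous (fun q : R * R => q.2 + del q)}.
    by apply: cvgD; [exact: cvg_snd|exact: del_cont].
  have c12 : {for q, continuous (fun q : R * R => (q.1 + e * del q, q.2 + del q))}.
    exact: (cvg_pair c1 c2).
  exact: (continuous_comp c12 cl).
- move=> u v _ _ Duv; rewrite /h /=.
  have -> : del (u, v) = 0.
    apply/eqP; rewrite eq_le del_ge0 andbT; apply: ge_inf; first by exists 0.
    by split => //=; rewrite mulr0 !addr0.
  by rewrite mulr0 !addr0.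
- move=> bd u v u00 v00 n; have e0 : e = 0 by rewrite /e; case: pselect.
  have [B sB] := bd.
  (* With e = 0 the ray is vertical and membership in the domain ignores u, so the first coordinate
     1 is an arbitrary choice. *)
  have del_u x : del (x, v) = del (1, v).
    rewrite /del; congr inf; apply/seteqP; split => t [t0 Dt]; split => //;
      exact: inv Dt.
  have -> : (fun x => h (x, v)) = laplace ^~ (v + del (1, v)).
    by apply/funext => x; rewrite /h/= e0 mul0r addr0 del_u.
  have [u1 [v1 [D1 hu1 hv1]]] := reach (1, v) ltr01 v00.
  exact: (laplace_smooth sB (rintegrable_laplace D1 hu1 hv1)).
Qed.

End LaplaceTransform.

(** * The duration kernel *)

Section ProductSigmaFinite.
Context {d1 d2} {X : measurableType d1} {Y : measurableType d2} {R : realType}.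
Variables (m1 : {sigma_finite_measure set X -> \bar R})
  (m2 : {sigma_finite_measure set Y -> \bar R}).

Lemma product_measure_sigma_finite : sigma_finite setT (m1 \x m2)%E.
Proof.
have /sigma_finiteP[F [F_T F_nd F_oo]] := sigma_finiteT m1.
have /sigma_finiteP[G [G_T G_nd G_oo]] := sigma_finiteT m2.
exists (fun n => F n `*` G n); last first.
  move=> n; have [mF Foo] := F_oo n; have [mG Goo] := G_oo n.
  split; first exact: measurableX.
  rewrite [ltLHS]product_measure1E// lte_mul_pinfty// ge0_fin_numE//.
apply/seteqP; split => // -[x y] _.
have : [set: X] x by []. have : [set: Y] y by [].
rewrite F_T G_T => -[j _ Gj] [i _ Fi].
exists (maxn i j) => //; split => /=.
  have /subsetPset := F_nd _ _ (leq_maxl i j); exact.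
have /subsetPset := G_nd _ _ (leq_maxr i j); exact.
Qed.

(** A name of its own lets the product measure carry the sigma-finite structure. *)
Definition sigma_finite_product : set (X * Y) -> \bar R := (m1 \x m2)%E.

HB.instance Definition _ := Measure.on sigma_finite_product.

HB.instance Definition _ := @Measure_isSigmaFinite.Build _ _ _
  sigma_finite_product product_measure_sigma_finite.

End ProductSigmaFinite.

Section DurationKernel.
Context {R : realType}.

Definition lebesgue2_sigma_finite : {sigma_finite_measure set (plane R) -> \bar R} :=
  sigma_finite_product (@lebesgue_measure R) (@lebesgue_measure R).

Let lam2 := lebesgue2_sigma_finite.

Lemma measurable_convex_set (T : set R) :
  convex_set (T : set (convex_lmodType R^o)) -> measurable T.
Proof.
move=> Tc; apply: is_interval_measurable => x y Tx Ty z /andP[xz zy].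
have [xy|yx] := ltP x y; last first.
  by have -> : z = x by apply/eqP; rewrite eq_le xz (le_trans zy).
(* The weight of x when z is written as a convex combination of x and y. *)
have l0 : 0 <= (y - z) / (y - x) by rewrite divr_ge0// subr_ge0// ltW.
have l1 : (y - z) / (y - x) <= 1 by rewrite ler_pdivrMr ?subr_gt0// mul1r lerD2l lerN2.
pose l := Itv01 l0 l1.
have := Tc x y l (mem_set Tx) (mem_set Ty); rewrite inE.
congr T; change ((y - z) / (y - x) * x + (1 - (y - z) / (y - x)) * y = z).
by field; rewrite subr_eq0 gt_eqF.
Qed.

Lemma duration_kernelE (a z : R * R) : duration_kernel a z =
  passage_density a.1 a.2 z.1 * passage_density a.1 a.2 z.2.
Proof.
rewrite /duration_kernel /passage_density expRD -[a.2 ^+ 2]real_normK ?num_real//.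
by rewrite expr2; ring.
Qed.

Lemma duration_kernel_ge0 (a z : R * R) : 0 <= duration_kernel a z.
Proof. by rewrite duration_kernelE mulr_ge0// passage_density_ge0. Qed.

Lemma measurable_duration_kernel : measurable_fun setT
  (fun p : plane R * plane R => duration_kernel p.1 p.2).
Proof.
have m11 : measurable_fun setT (fun p : plane R * plane R => p.1.1).
  by apply: (measurableT_comp measurable_fst); exact: measurable_fst.
have m12 : measurable_fun setT (fun p : plane R * plane R => p.1.2).
  by apply: (measurableT_comp measurable_snd); exact: measurable_fst.
have m21 : measurable_fun setT (fun p : plane R * plane R => p.2.1).
  by apply: (measurableT_comp measurable_fst); exact: measurable_snd.
have m22 : measurable_fun setT (fun p : plane R * plane R => p.2.2).
  by apply: (measurableT_comp measurable_snd); exact: measurable_snd.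
have mq (f : plane R * plane R -> R) : measurable_fun setT f ->
    measurable_fun setT (fun p : plane R * plane R => (p.1.1 * f p - p.1.2) ^+ 2 / (2 * f p)).
  move=> mf; apply: measurable_funM.
    by apply: measurable_funX; apply: measurable_funB => //; exact: measurable_funM.
  by apply: (measurableT_comp (@measurable_invr R)); exact: measurable_funM.
apply: measurable_funM.
  apply: measurable_funM.
    apply: measurable_funM; first exact: measurable_funX.
    exact: (measurableT_comp (measurable_powR _) m21).
  exact: (measurableT_comp (measurable_powR _) m22).
apply: (measurableT_comp (@measurable_expR R)).
apply: measurable_funB; last exact: mq.
by apply: measurableT_comp => //; exact: mq.
Qed.

Lemma integral_tensor_le (f : R -> R) (C : R) : measurable_fun setT f ->
  (forall t, 0 <= f t) -> (\int[lebesgue_measure]_t (f t)%:E <= C%:E)%E ->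
  (\int[lam2]_z (f z.1 * f z.2)%:E <= (C ^+ 2)%:E)%E.
Proof.
move=> mf f0 fC.
have if0 : (0 <= \int[lebesgue_measure]_t (f t)%:E)%E.
  by apply: integral_ge0 => t _; rewrite lee_fin.
have C0 : 0 <= C by rewrite -lee_fin (le_trans if0).
have mff : measurable_fun setT
    (fun z : measurableTypeR R * measurableTypeR R => (f z.1 * f z.2)%:E).
  apply/measurable_EFinP; apply: measurable_funM.
    exact: (measurableT_comp mf measurable_fst).
  exact: (measurableT_comp mf measurable_snd).
have -> : (\int[lam2]_z (f z.1 * f z.2)%:E =
    \int[lebesgue_measure]_x \int[lebesgue_measure]_y (f x * f y)%:E)%E.
  have ff0 z : (0 <= (f z.1 * f z.2)%:E)%E by rewrite lee_fin mulr_ge0.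
  exact: (@fubini_tonelli1 _ _ _ _ _ (@lebesgue_measure R) (@lebesgue_measure R) _ mff ff0).
under eq_integral => x _.
  under eq_integral do rewrite EFinM.
  rewrite ge0_integralZl//; last 3 first.
  - exact/measurable_EFinP.
  - by move=> t _; rewrite lee_fin.
  - by rewrite lee_fin.
  over.
rewrite ge0_integralZr//; last 2 first.
- exact/measurable_EFinP.
- by move=> t _; rewrite lee_fin.
by rewrite expr2 EFinM lee_pmul.
Qed.

Variable T : set R.
Hypotheses (T_ge0 : T `<=` [set t | 0 <= t]) (mT : measurable T).

Let TT := T `*` T.

Let mTT : measurable (TT : set (plane R)).
Proof. exact: measurableX. Qed.

Let m1TT : measurable_fun setT (\1_TT : plane R -> R).
Proof. exact: measurable_indic. Qed.

Definition truncated_kernel (p : plane R * plane R) : R :=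
  duration_kernel p.1 p.2 * \1_TT p.2.

Lemma measurable_truncated_kernel : measurable_fun setT truncated_kernel.
Proof.
apply: measurable_funM; first exact: measurable_duration_kernel.
exact: (measurableT_comp m1TT measurable_snd).
Qed.

Lemma truncated_kernel_ge0 p : 0 <= truncated_kernel p.
Proof. by rewrite mulr_ge0// duration_kernel_ge0. Qed.

(** The bound uniform in [a] behind the constant [M] of the score operator. *)
Lemma integral_truncated_kernel_le (a : R * R) :
  (\int[lam2]_z (truncated_kernel (a, z))%:E <= ((4 * pi) ^+ 2)%:E)%E.
Proof.
pose f t := passage_density a.1 a.2 t * \1_T t.
have mf : measurable_fun setT f.
  by apply: measurable_funM; [exact: measurable_passage_density|exact: measurable_indic].
have f0 t : 0 <= f t by rewrite mulr_ge0// passage_density_ge0.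
have -> : (\int[lam2]_z (truncated_kernel (a, z))%:E =
    \int[lam2]_z (f z.1 * f z.2)%:E)%E.
  apply: eq_integral => z _; rewrite /truncated_kernel /f/= duration_kernelE.
  have -> : \1_TT z = \1_T z.1 * \1_T z.2 :> R.
    rewrite !indicE /TT in_setX.
    by case: (_ \in _); case: (_ \in _); rewrite ?mulr1 ?mulr0.
  by rewrite mulrACA.
apply: integral_tensor_le => //; apply: le_trans (integral_passage_density_le a.1 a.2).
have -> : (\int[lebesgue_measure]_t (f t)%:E =
    \int[lebesgue_measure]_(t in T) (passage_density a.1 a.2 t)%:E)%E.
  rewrite [RHS]integral_mkcond; apply: eq_integral => t _.
  by rewrite /f patchE indicE; case: ifP => _; rewrite ?mulr1 ?mulr0.
have mpd A : measurable_fun A (fun t => (passage_density a.1 a.2 t)%:E).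
  by apply/measurable_funTS/measurable_EFinP; exact: measurable_passage_density.
have T0oo : T `<=` `[0, +oo[%classic.
  by move=> t /T_ge0; rewrite /= in_itv/= andbT.
apply: (@le_trans _ _ (\int[lebesgue_measure]_(t in `[0%R, +oo[) (passage_density a.1 a.2 t)%:E)%E).
  apply: (@ge0_subset_integral _ _ R lebesgue_measure _ _ mT (measurable_itv _) _
    (mpd _) _ T0oo) => t _.
  by rewrite lee_fin passage_density_ge0.
by rewrite -(integral_itv_obnd_cbnd (r := 0)).
Qed.

Lemma rintegrable_truncated_kernel (a : R * R) :
  rintegrable lam2 (fun z => truncated_kernel (a, z)).
Proof.
apply: rintegrable_lty.
- exact: (measurable_section_r a measurable_truncated_kernel).
- by move=> z; exact: truncated_kernel_ge0.
- by rewrite (le_lt_trans (integral_truncated_kernel_le a))// ltry.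
Qed.

Definition duration_weight (z : plane R) : R :=
  \1_TT z * (z.1 `^ (- (3 / 2)) * z.2 `^ (- (3 / 2))).

(** The indicator makes the exponent nonnegative, and bounded for bounded T, on the whole plane; off
    T x T the kernel vanishes through [duration_weight]. *)
Definition duration_sum (z : plane R) : R := \1_TT z * ((z.1 + z.2) / 2).

Definition duration_inverse_sum (z : plane R) : R :=
  \1_TT z * ((z.1^-1 + z.2^-1) / 2).

Let m1 : measurable_fun setT (fun z : plane R => z.1).
Proof. exact: measurable_fst. Qed.

Let m2 : measurable_fun setT (fun z : plane R => z.2).
Proof. exact: measurable_snd. Qed.

Lemma measurable_duration_weight : measurable_fun setT duration_weight.
Proof.
apply: measurable_funM => //; apply: measurable_funM.
  exact: (measurableT_comp (measurable_powR _) m1).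
exact: (measurableT_comp (measurable_powR _) m2).
Qed.

Lemma measurable_duration_sum : measurable_fun setT duration_sum.
Proof.
by apply: measurable_funM => //; apply: measurable_funM => //; exact: measurable_funD.
Qed.

Lemma measurable_duration_inverse_sum : measurable_fun setT duration_inverse_sum.
Proof.
apply: measurable_funM => //; apply: measurable_funM => //; apply: measurable_funD.
  exact: (measurableT_comp (@measurable_invr R) m1).
exact: (measurableT_comp (@measurable_invr R) m2).
Qed.

Lemma duration_weight_ge0 z : 0 <= duration_weight z.
Proof. by rewrite !mulr_ge0// powR_ge0. Qed.

Lemma duration_sum_ge0 z : 0 <= duration_sum z.
Proof.
rewrite /duration_sum indicE; have [|_] := boolP (z \in TT); last by rewrite mul0r.
by rewrite inE => -[/T_ge0/= z1 /T_ge0/= z2]; rewrite mul1r divr_ge0// addr_ge0.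
Qed.

Lemma duration_inverse_sum_ge0 z : 0 <= duration_inverse_sum z.
Proof.
rewrite /duration_inverse_sum indicE; have [|_] := boolP (z \in TT); last by rewrite mul0r.
rewrite inE => -[/T_ge0/= z1 /T_ge0/= z2].
by rewrite mul1r divr_ge0// addr_ge0// invr_ge0.
Qed.

Lemma duration_sum_bounded : bounded_set T -> exists B, forall z, duration_sum z <= B.
Proof.
move=> [M [_ TM]]; exists (`|M| + 1) => z.
have M0 : 0 <= `|M| + 1 by rewrite addr_ge0.
have MM : M < `|M| + 1 by rewrite (le_lt_trans (ler_norm M))// ltrDl.
rewrite /duration_sum indicE; have [|_] := boolP (z \in TT); last by rewrite mul0r.
rewrite inE => -[/(TM _ MM)/= z1 /(TM _ MM)/= z2].
have := ler_norm z.1; have := ler_norm z.2; lra.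
Qed.

(** Since (a1 t - a2)^2 / (2 t) = a1^2 t / 2 - a1 a2 + a2^2 / (2 t), the cross term does not depend
    on t and leaves the kernel as the factor exp (2 a1 a2). *)
Lemma truncated_kernel_laplace (a z : R * R) : truncated_kernel (a, z) =
  a.2 ^+ 2 * expR (2 * a.1 * a.2) *
  laplace_kernel duration_weight duration_sum duration_inverse_sum
    (a.1 ^+ 2) (a.2 ^+ 2) z.
Proof.
rewrite /truncated_kernel /laplace_kernel /duration_weight /duration_sum.
rewrite /duration_inverse_sum /duration_kernel /= indicE.
have [|_] := boolP (z \in TT); last by rewrite !(mul0r, mulr0).
rewrite inE => -[/T_ge0/= z1 /T_ge0/= z2]; rewrite !(mul1r, mulr1).
(* T may contain 0, where the expansion fails; both sides vanish there because this power of 0 is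
   0. *)
have p0 : (0 : R) `^ (- (3 / 2)) = 0.
  by rewrite powR0// oppr_eq0 mulf_neq0// invr_neq0.
have [->|z10] := eqVneq z.1 0; first by rewrite p0 !(mul0r, mulr0).
have [->|z20] := eqVneq z.2 0; first by rewrite p0 !(mul0r, mulr0).
set x := z.1 `^ _; set y := z.2 `^ _.
have -> : - ((a.1 * z.1 - a.2) ^+ 2 / (2 * z.1)) - (a.1 * z.2 - a.2) ^+ 2 / (2 * z.2) =
    2 * a.1 * a.2 + (- (a.1 ^+ 2 * ((z.1 + z.2) / 2)) -
      a.2 ^+ 2 * ((z.1^-1 + z.2^-1) / 2)) by field; rewrite z10 z20.
by rewrite expRD; ring.
Qed.

(** Up to a nonzero factor, this is the truncated kernel at a = (sqrt u, sqrt v). *)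
Lemma rintegrable_duration_laplace_kernel u v : 0 < u -> 0 < v ->
  rintegrable lam2
    (laplace_kernel duration_weight duration_sum duration_inverse_sum u v).
Proof.
move=> u0 v0; pose a := (Num.sqrt u, Num.sqrt v).
have C0 : a.2 ^+ 2 * expR (2 * a.1 * a.2) != 0.
  by rewrite mulf_neq0// ?gt_eqF ?expR_gt0// exprn_gt0// sqrtr_gt0.
have := rintegrableZ (a.2 ^+ 2 * expR (2 * a.1 * a.2))^-1 (rintegrable_truncated_kernel a).
congr rintegrable; apply/funext => z; rewrite truncated_kernel_laplace mulrA mulVf// mul1r.
by rewrite !sqr_sqrtr ?ltW.
Qed.

End DurationKernel.

(** * Score operator and efficiency bound of the duration model *)

Section SquareIntegrableLfun.
Context {d} {X : measurableType d} {R : realType}.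
Variable mu : {measure set X -> \bar R}.
Implicit Types f g : X -> R.

Lemma Lnorm2_sqr f :
  ('N[mu]_2%:E[EFin \o f] `^ 2 = \int[mu]_x (f x ^+ 2)%:E)%E.
Proof.
rewrite powR_Lnorm//; apply: eq_integral => x _ /=.
by rewrite powR_mulrn// real_normK// num_real.
Qed.

Lemma square_integrable_Lfun f : square_integrable mu f <-> f \in Lfun mu 2%:E.
Proof.
split=> [[mf hf]|hf]; last first.
  split; last exact: Lfun2_integrable_sqr.
  by move: hf; rewrite inE => /andP[]; rewrite inE.
rewrite inE; apply/andP; split; rewrite inE//= /finite_norm.
apply: (@lty_poweRy _ _ 2) => //.
by rewrite Lnorm2_sqr -EFin_Rintegral// ltry.
Qed.

Lemma inner_lt_Lnorm f (e : R) : square_integrable mu f -> 0 < e ->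
  ('N[mu]_2%:E[EFin \o f] < (Num.sqrt e)%:E)%E -> inner mu f f < e.
Proof.
move=> hf e0; have := Lnorm2_sqr f; have := Lnorm_ge0 mu 2%:E (EFin \o f).
case: ('N[mu]_2%:E[EFin \o f])%E => [n n0|//|//].
rewrite -(EFin_Rintegral hf.2) poweR_EFin => -[nE]; rewrite lte_fin => ne.
rewrite lee_fin in n0.
have -> : inner mu f f = n ^+ 2.
  by rewrite -powR_mulrn// nE.
by rewrite -[ltRHS](sqr_sqrtr (ltW e0)) ltrXn2r// nnegrE sqrtr_ge0.
Qed.

End SquareIntegrableLfun.

Section TangentSpace.
Context {R : realType}.
Variables (H : set (probability (plane R) R)) (eta0 : probability (plane R) R).
Implicit Types b : R * R -> R.

Lemma tangent_space_square_integrable b :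
  tangent_space H eta0 b -> square_integrable eta0 b.
Proof.
move=> [n [c [s [hs ->]]]]; elim: n c s hs => [|n IH] c s hs.
  by under eq_fun do rewrite big_ord0; exact: square_integrable_cst.
under eq_fun do rewrite big_ord_recl; apply: square_integrableD.
  by apply/square_integrableZ/square_integrable_Lfun; have [] := hs ord0.
by apply: (IH (fun i => c (lift ord0 i)) (fun i => s (lift ord0 i))) => i.
Qed.

Lemma tangent_space_combination b b' (t : R) :
  tangent_space H eta0 b -> tangent_space H eta0 b' ->
  tangent_space H eta0 (fun a => b a + t * b' a).
Proof.
move=> [n [c [s [hs ->]]]] [n' [c' [s' [hs' ->]]]].
exists (n + n')%N.
exists (fun i : 'I_(n + n') => match fintype.split i with inl j => c j | inr j => t * c' j end).
exists (fun i : 'I_(n + n') => match fintype.split i with inl j => s j | inr j => s' j end).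
split=> [i|]; first by case: fintype.split.
apply/funext => a; rewrite big_split_ord/= mulr_sumr; congr (_ + _).
  apply: eq_bigr => i _.
  by have -> : fintype.split (lshift n' i) = inl i := unsplitK (inl i).
apply: eq_bigr => i _; rewrite mulrA.
by have -> : fintype.split (rshift n i) = inr i := unsplitK (inr i).
Qed.

End TangentSpace.

Section EfficiencyBound.
Context {R : realType}.
Variables (T : set R) (H : set (probability (plane R) R)).
Variables (eta0 P : probability (plane R) R) (r : R * R -> R).

Lemma efficiency_bound_le :
  (forall b, tangent_space H eta0 b ->
     square_integrable P (score_operator T eta0 P b)) ->
  (efficiency_bound T H eta0 P r < +oo)%E ->
  exists2 K : R, 0 <= K & forall b, tangent_space H eta0 b ->
    (\int[eta0]_a ((r a - phi r eta0) * b a)) ^+ 2 <=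
    K * \int[P]_z (score_operator T eta0 P b z) ^+ 2.
Proof.
move=> hscore; rewrite /efficiency_bound; set S := [set x | _]; move=> supoo.
exists `|fine (ereal_sup S)| => // b Vb.
set n := (X in X <= _); set m := \int[P]_z _.
have n0 : 0 <= n by exact: sqr_ge0.
have m0 : 0 <= m by apply: Rintegral_ge0 => z _; rewrite sqr_ge0.
have xS : (n%:E / m%:E <= ereal_sup S)%E.
  apply: ereal_sup_ubound; exists b => //.
  (* The real and extended integrals agree because the score is square integrable. *)
  have -> : (m%:E = \int[P]_z (score_operator T eta0 P b z ^+ 2)%:E)%E by exact: EFin_Rintegral (hscore b Vb).2.
  by [].
(* A positive numerator over 0 would be +oo and contradict the finite supremum, so the numerator is
   0 as well. *)
have [m00|mN0] := eqVneq m 0.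
  rewrite m00 mulr0; apply: contraT; rewrite -ltNge => ngt0.
  move: xS; rewrite m00 inve0 mulry gtr0_sg// mul1e => h.
  by move: (le_lt_trans h supoo); rewrite ltxx.
have mgt0 : 0 < m by rewrite lt_neqAle eq_sym mN0.
move: xS; rewrite inver (negbTE mN0) -EFinM => h.
have supfin : ereal_sup S \is a fin_num.
  by rewrite fin_numElt supoo andbT (lt_le_trans _ h)// ltNyr.
rewrite -ler_pdivrMr// (le_trans _ (ler_norm _))// -lee_fin fineK//.
Qed.

End EfficiencyBound.

Section ScoreOperator.
Context {R : realType}.
Variables (T : set R) (mT : measurable T).
Variables (eta0 P : probability (plane R) R).
Hypothesis P_law : is_law_Z T eta0 P.

Let lam2 := @lebesgue2_sigma_finite R.

Let TT := T `*` T.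

(** The joint density q for [eta0] and Lebesgue measure on the whole plane: the indicator replaces
    integration over T x T. *)
Definition truncated_density (p : plane R * plane R) : R :=
  norm_const T eta0 * truncated_kernel T p.

Lemma norm_const_ge0 : 0 <= norm_const T eta0.
Proof.
rewrite invr_ge0; apply: Rintegral_ge0 => z _; apply: Rintegral_ge0 => a _.
exact: duration_kernel_ge0.
Qed.

Lemma measurable_truncated_density : measurable_fun setT truncated_density.
Proof. by apply: measurable_funM => //; exact: measurable_truncated_kernel. Qed.

Lemma truncated_density_ge0 p : 0 <= truncated_density p.
Proof. by rewrite mulr_ge0// ?norm_const_ge0// truncated_kernel_ge0. Qed.

Lemma integral_truncated_density_le (T_ge0 : T `<=` [set t | 0 <= t]) (a : R * R) :
  (\int[lam2]_z (truncated_density (a, z))%:E <=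
   (norm_const T eta0 * (4 * pi) ^+ 2)%:E)%E.
Proof.
rewrite /truncated_density; under eq_integral do rewrite EFinM.
have mq : measurable_fun setT (fun z : plane R => (truncated_kernel T (a, z))%:E).
  apply/measurable_EFinP.
  exact: (measurable_section_r a (measurable_truncated_kernel mT)).
rewrite ge0_integralZl//; last 2 first.
- by move=> z _; rewrite lee_fin truncated_kernel_ge0.
- by rewrite lee_fin norm_const_ge0.
rewrite EFinM lee_wpmul2l ?lee_fin ?norm_const_ge0//.
exact: integral_truncated_kernel_le.
Qed.

Lemma truncated_densityE a z : TT z -> truncated_density (a, z) = cond_density T eta0 a z.
Proof.
by move=> TTz; rewrite /truncated_density /truncated_kernel indicE mem_set ?mulr1.
Qed.

Lemma marginal_truncated_density z : TT z ->
  marginal eta0 truncated_density z = density_Z T eta0 z.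
Proof. by move=> TTz; apply: eq_Rintegral => a _; rewrite truncated_densityE. Qed.

Lemma marginal_truncated_density0 z : ~ TT z ->
  marginal eta0 truncated_density z = 0.
Proof.
move=> TTz; transitivity (\int[eta0]_a (0 : R)).
  apply: eq_Rintegral => a _; rewrite /truncated_density /truncated_kernel.
  by rewrite indicE memNset// !mulr0.
by rewrite Rintegral_cst// mul0r.
Qed.

Lemma law_Z_marginal A : measurable A ->
  P A = (\int[lam2]_(z in A) (marginal eta0 truncated_density z)%:E)%E.
Proof.
move=> mA; rewrite (P_law mA) /law_Z integral_mkcondr.
transitivity (\int[@lebesgue2 R]_(z in A) (marginal eta0 truncated_density z)%:E)%E.
  apply: eq_integral => z _; rewrite patchE; case: ifPn => [|/negP]; rewrite inE => zTT.
    by rewrite marginal_truncated_density.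
  by rewrite marginal_truncated_density0.
reflexivity.
Qed.

Lemma ae_law_Z : {ae P, forall z, TT z}.
Proof.
exists (~` TT); split.
- by apply: measurableC; exact: measurableX.
- rewrite P_law; first by rewrite /law_Z setICl integral_set0.
  by apply: measurableC; exact: measurableX.
- by move=> z.
Qed.

Lemma measurable_score_operator (b : plane R -> R) : measurable_fun setT b ->
  measurable_fun setT (score_operator T eta0 P b).
Proof.
move=> mb.
have mc : measurable_fun setT (fun p : plane R * plane R => cond_density T eta0 p.1 p.2).
  by apply: measurable_funM => //; exact: measurable_duration_kernel.
apply: measurable_funB => //; apply: measurable_funM.
  apply: (@measurable_Rintegral_l _ _ _ _ _ eta0
    (fun p : plane R * plane R => b p.1 * cond_density T eta0 p.1 p.2)).
  by apply: measurable_funM => //; exact: (measurableT_comp mb measurable_fst).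
apply: (measurableT_comp (@measurable_invr R)).
exact: (@measurable_Rintegral_l _ _ _ _ _ eta0
  (fun p : plane R * plane R => cond_density T eta0 p.1 p.2) mc).
Qed.

(** The two sides may differ off T x T, where [score_operator] keeps the untruncated kernel; this
    set is [P]-null. *)
Lemma ae_score_operator (b : plane R -> R) : measurable_fun setT b ->
  {ae P, forall z : plane R, score_operator T eta0 P b z =
    centered_posterior eta0 P truncated_density b z}.
Proof.
(* The uncentered scores are compared first, because the centering constants are their integrals. *)
move=> mb; pose m := \int[P]_z (\int[eta0]_a (b a * cond_density T eta0 a z) / density_Z T eta0 z).
have mpost := measurable_posterior eta0 measurable_truncated_density truncated_density_ge0 mb.
have mS : measurable_fun setT (fun z : plane R => score_operator T eta0 P b z + m).
  by apply: measurable_funD => //; exact: measurable_score_operator.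
have Spost : {ae P, forall z : plane R, score_operator T eta0 P b z + m =
    posterior eta0 truncated_density b z}.
  apply: ae_imply ae_law_Z => z TTz; rewrite /score_operator subrK.
  rewrite /posterior marginal_truncated_density//.
  by congr (_ / _); apply: eq_Rintegral => a _; rewrite truncated_densityE.
have mE : m = \int[P]_z posterior eta0 truncated_density b z.
  rewrite -(ae_eq_Rintegral mS mpost Spost).
  by apply: eq_Rintegral => z _; rewrite /score_operator subrK.
by apply: ae_imply Spost => z Sz; rewrite /centered_posterior -Sz -mE addrK.
Qed.

Hypothesis T_ge0 : T `<=` [set t | 0 <= t].

Lemma square_integrable_score_operator (b : plane R -> R) : square_integrable eta0 b ->
  square_integrable P (score_operator T eta0 P b).
Proof.
move=> hb.
have hcp : square_integrable P (centered_posterior eta0 P truncated_density b).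
  apply: square_integrableB; last exact: square_integrable_cst.
  exact: (square_integrable_posterior measurable_truncated_density
    truncated_density_ge0 (integral_truncated_density_le T_ge0) law_Z_marginal hb).
have cp_score : {ae P, forall z : plane R, centered_posterior eta0 P truncated_density b z =
    score_operator T eta0 P b z}.
  by apply: ae_imply (ae_score_operator hb.1) => z ->.
exact: square_integrable_ae_eq hcp (measurable_score_operator hb.1) cp_score.
Qed.

Lemma Rintegral_score_operator (b : plane R -> R) : square_integrable eta0 b ->
  \int[P]_z (score_operator T eta0 P b z) ^+ 2 =
  inner P (centered_posterior eta0 P truncated_density b)
    (centered_posterior eta0 P truncated_density b).
Proof.
move=> hb.
have mpost := measurable_posterior eta0 measurable_truncated_density
  truncated_density_ge0 hb.1.
have mcp : measurable_fun setT (centered_posterior eta0 P truncated_density b).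
  by apply: measurable_funB.
apply: ae_eq_Rintegral.
- by apply: measurable_funX; exact: measurable_score_operator hb.1.
- exact: measurable_funM.
- by apply: ae_imply (ae_score_operator hb.1) => z ->; rewrite expr2.
Qed.

End ScoreOperator.

Unset Implicit Arguments.

Theorem proposition3p1 (R : realType) (T : set R)
    (T_ge0 : T `<=` [set t | 0 <= t])
    (T_convex : convex_set (T : set (convex_lmodType R^o)))
    (T_interior : T°%classic !=set0)
    (H : set (probability (plane R) R))
    (H_UH : distributions_on_UH H)
    (eta0 : probability (plane R) R) (H_eta0 : H eta0)
    (P : probability (plane R) R) (P_law : is_law_Z T eta0 P)
    (UH_nonparametric : nonparametric H eta0)
    (r : R * R -> R) (r_L2 : r \in Lfun eta0 2%:E)
    (r_locally_bounded :
      forall a, UH_space a -> bounded_near r (within UH_space (nbhs a)))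
    (phi_regular : regularly_identified T H eta0 P r) :
  exists (C1 C2 : R) (h : R * R -> R),
    [/\ {within [set uv : R * R | 0 < uv.1 /\ 0 < uv.2], continuous h},
        {ae eta0, forall a : R * R, a.1 != 0 -> 0 < a.2 ->
           r a = C1 + C2 * a.2 ^+ 2 * expR (2 * a.1 * a.2)
                      * h (a.1 ^+ 2, a.2 ^+ 2)} &
        bounded_set T ->
        forall u v : R, 0 < u -> 0 < v ->
        forall n : nat, derivable (fun w : R => h (w, v))^`(n)%classic u 1].
Proof.
have mT := measurable_convex_set T_convex.
have hscore b : tangent_space H eta0 b -> square_integrable P (score_operator T eta0 P b).
  move=> /tangent_space_square_integrable.
  exact: square_integrable_score_operator.
have [K K0 VK] := efficiency_bound_le hscore phi_regular.2.
have [c [g [mg ae_r]]] : exists (c : R) (g : plane R -> R),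
    measurable_fun setT g /\ {ae eta0, forall a : plane R,
      rintegrable (@lebesgue2_sigma_finite R)
        (fun z => g z ^+ 2 * truncated_density T eta0 (a, z)) /\
      r a = c + adjoint (@lebesgue2_sigma_finite R) (truncated_density T eta0) g a}.
  apply: (@adjoint_representation _ _ _ _ _ eta0 (@lebesgue2_sigma_finite R) P
    (truncated_density T eta0) _ (measurable_truncated_density mT eta0)
    (truncated_density_ge0 T eta0) (integral_truncated_density_le mT eta0 T_ge0)
    (law_Z_marginal P_law) (tangent_space H eta0) r K).
  - by move=> b; exact: tangent_space_square_integrable.
  - by move=> b b' t; exact: tangent_space_combination.
  - move=> k hk k0 e e0.
    have Lk : L20 eta0 k by split=> //; exact/square_integrable_Lfun.
    (* The density hypothesis bounds a norm, the goal its square. *)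
    have [|b Vb kb] := UH_nonparametric k Lk (Num.sqrt e); first by rewrite sqrtr_gt0.
    exists b => //; apply: inner_lt_Lnorm e0 kb.
    exact: square_integrableB hk (tangent_space_square_integrable Vb).
  - exact/square_integrable_Lfun.
  - exact: K0.
  - move=> b Vb; have hb := tangent_space_square_integrable Vb.
    by rewrite -(Rintegral_score_operator mT P_law hb); exact: VK.
have [h [h_cont hE h_smooth]] := laplace_extension
  (measurable_duration_weight mT) (measurable_duration_sum mT)
  (measurable_duration_inverse_sum mT) mg (@duration_weight_ge0 _ T)
  (duration_sum_ge0 T_ge0) (duration_inverse_sum_ge0 T_ge0)
  (rintegrable_duration_laplace_kernel T_ge0 mT).
(* [h] comes from the unnormalized kernel, so C2 is the normalizing constant. *)
exists c, (norm_const T eta0), h; split => //; last first.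
  by move=> /duration_sum_bounded; exact: h_smooth.
apply: ae_imply ae_r => a [ig2 ->] a10 a20; congr (_ + _).
set C := norm_const T eta0 * _ * _.
have qE z : truncated_density T eta0 (a, z) = C * laplace_kernel (duration_weight T)
    (duration_sum T) (duration_inverse_sum T) (a.1 ^+ 2) (a.2 ^+ 2) z.
  by rewrite /truncated_density (truncated_kernel_laplace T_ge0) !mulrA.
have a12 : 0 < a.1 ^+ 2 by rewrite exprn_even_gt0.
have a22 : 0 < a.2 ^+ 2 by rewrite exprn_gt0.
(* If C = 0, then q(a, .) is 0 and both sides reduce to [c]; otherwise dividing by C puts (a1^2,
   a2^2) in the domain where [h] equals the transform. *)
have [C0|C0] := eqVneq C 0.
  rewrite C0 mul0r /adjoint; transitivity (\int[@lebesgue2_sigma_finite R]_z (0 : R)).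
    by apply: eq_Rintegral => z _; rewrite qE C0 mul0r mulr0.
  by rewrite Rintegral_cst// mul0r.
have D : square_domain (@lebesgue2_sigma_finite R) (duration_weight T)
    (duration_sum T) (duration_inverse_sum T) g (a.1 ^+ 2) (a.2 ^+ 2).
  have := rintegrableZ C^-1 ig2; congr rintegrable; apply/funext => z.
  by rewrite qE mulrCA mulKf.
rewrite hE// /laplace -RintegralZl//.
  by apply: eq_Rintegral => z _; rewrite qE mulrCA.
apply: rintegrable_laplace D _ _ => //.
- exact: measurable_duration_weight.
- exact: measurable_duration_sum.
- exact: measurable_duration_inverse_sum.
- exact: duration_weight_ge0.
- exact: rintegrable_duration_laplace_kernel.
- by rewrite ltr_pMl// ltr1n.
- by rewrite ltr_pMl// ltr1n.
Qed.
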